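(* Let $p\in[1,\infty)$ and let $\varphi:\mathcal{X}\times[0,1]\to\mathbb{R}$ be a bounded, measurable, non-anticipative function. (i) Let $\mathbb{X},\mathbb{Y}\in\mathcal{FP}_p$. If $\mathcal{AW}_p(\mathbb{X},\mathbb{Y})=0$, then $\mathrm{OS}(\mathbb{X},\varphi)=\mathrm{OS}(\mathbb{Y},\varphi)$. (ii) Let $\mathbb{X},\mathbb{X}^n\in\mathcal{FP}_p$, $n\in\mathbb{N}$, be such that $\mathcal{AW}_p(\mathbb{X}^n,\mathbb{X})\to0$. If $X$ has almost surely continuous paths and $\varphi$ is continuous, then $\mathrm{OS}(\mathbb{X}^n,\varphi)\to\mathrm{OS}(\mathbb{X},\varphi)$.
   Context: $\mathcal{X}=D([0,1];\mathbb{R})$ (càdlàg paths, $J_1$-topology), with a fixed complete metric $d_{\mathcal{X}}$ inducing the $J_1$-topology and satisfying $d_{\mathcal{X}}(f,0)\le C\|f\|_\infty$ for some constant $C$ ($0$ denotes the zero path). A filtered process is a tuple $\mathbb{X}=(\Omega^{\mathbb{X}},\mathcal{F}^{\mathbb{X}},\mathbb{P}^{\mathbb{X}},(\mathcal{F}^{\mathbb{X}}_t)_{t\in[0,1]},X)$ where $(\Omega^{\mathbb{X}},\mathcal{F}^{\mathbb{X}},\mathbb{P}^{\mathbb{X}})$ is a probability space, $(\mathcal{F}^{\mathbb{X}}_t)$ a filtration satisfying the usual conditions and $X$ an adapted càdlàg process. $\mathcal{FP}_p$ is the collection of filtered processes with $\mathbb{E}_{\mathbb{P}^{\mathbb{X}}}[d^p_{\mathcal{X}}(0,X)]<\infty$.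 Times larger than $1$ are read as $1$. A coupling of $\mathbb{X},\mathbb{Y}$ is a probability measure on $(\Omega^{\mathbb{X}}\times\Omega^{\mathbb{Y}},\mathcal{F}^{\mathbb{X}}\otimes\mathcal{F}^{\mathbb{Y}})$ with marginals $\mathbb{P}^{\mathbb{X}},\mathbb{P}^{\mathbb{Y}}$. For $\varepsilon\ge0$ it is $\varepsilon$-causal from $\mathbb{X}$ to $\mathbb{Y}$ if for all $t\in[0,1]$, under $\pi$, $\mathcal{F}^{\mathbb{Y}}_t$ is conditionally independent of $\mathcal{F}^{\mathbb{X}}_1$ given $\mathcal{F}^{\mathbb{X}}_{t+\varepsilon}$, and $\varepsilon$-bicausal if it is $\varepsilon$-causal in both directions. $\mathrm{Cpl}^\varepsilon_{\mathrm{bc}}(\mathbb{X},\mathbb{Y})$ is the set of $\varepsilon$-bicausal couplings, and $$\mathcal{AW}_p(\mathbb{X},\mathbb{Y})=\inf_{\varepsilon\ge0}\inf\{\mathbb{E}_\pi[d^p_{\mathcal{X}}(X,Y)]^{1/p}+\varepsilon:\pi\in\mathrm{Cpl}^\varepsilon_{\mathrm{bc}}(\mathbb{X},\mathbb{Y})\}.$$ $\varphi$ is non-anticipative if $\varphi(f,t)=\varphi(g,t)$ whenever $t\in[0,1]$ and $f,g\in\mathcal{X}$ coincide on $[0,t]$. The optimal stopping value is $\mathrm{OS}(\mathbb{X},\varphi)=\inf\{\mathbb{E}_{\mathbb{P}^{\mathbb{X}}}[\varphi(X,\tau)]:\tau\text{ is a }[0,1]\text{-valued }(\mathcal{F}^{\mathbb{X}}_t)_{t}\text{-stopping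 time}\}$. *)

(* Defs.v *)
From HB Require Import structures.
From mathcomp Require Import all_boot all_order all_algebra.
From mathcomp Require Import all_classical all_reals all_analysis.

Set Implicit Arguments.
Unset Strict Implicit.
Unset Printing Implicit Defensive.

Import Order.TTheory GRing.Theory Num.Theory.
Import numFieldNormedType.Exports.

Local Open Scope classical_set_scope.
Local Open Scope ring_scope.

Definition is_cadlag (R : realType) (f : R -> R) : Prop :=
  (forall t, 0 <= t < 1 -> f x @[x --> t^'+] --> f t) /\
  (forall t, 0 < t <= 1 -> cvg (f x @[x --> t^'-])).

Definition clamp01 (R : realType) (t : R) : R := Num.max 0 (Num.min t 1).

(* A path on [0,1] is represented by its extension to R that is constant on
   ]-oo,0] and on [1,+oo[, so that Leibniz equality of two paths amounts to
   equality on [0,1]. *)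
Record cadlag (R : realType) := Cadlag {
  cadlag_fun :> R -> R ;
  cadlagP : is_cadlag cadlag_fun ;
  cadlag_clamp : forall t, cadlag_fun t = cadlag_fun (clamp01 t) }.

Lemma cst_is_cadlag (R : realType) (c : R) : is_cadlag (fun=> c).
Proof.
by split=> t _; [exact: cvg_cst | apply/cvg_ex; exists c; exact: cvg_cst].
Qed.

Definition cadlag0 (R : realType) : cadlag R :=
  Cadlag (cst_is_cadlag (0 : R)) (fun=> erefl).

HB.instance Definition _ (R : realType) := gen_eqMixin (cadlag R).
HB.instance Definition _ (R : realType) := gen_choiceMixin (cadlag R).
HB.instance Definition _ (R : realType) := isPointed.Build (cadlag R) (cadlag0 R).

Definition sup_norm (R : realType) (u : R -> R) : R :=
  sup [set `|u t| | t in `[0, 1]].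

Definition time_changes (R : realType) : set (R -> R) :=
  [set l : R -> R | [/\ l 0 = 0, l 1 = 1, {within `[0, 1], continuous l} &
               {in `[(0 : R), 1] &, {homo l : s t / s < t}}]].

Definition skorokhod_dist (R : realType) (f g : cadlag R) : R :=
  inf [set Num.max (sup_norm (fun t => l t - t))
                   (sup_norm (fun t => f t - g (l t)))
      | l in @time_changes R].

Section J1_topology.
Variable R : realType.

Definition J1_open : set_system (cadlag R) :=
  [set U | forall f, U f ->
     exists2 e : R, 0 < e & forall g, skorokhod_dist f g < e -> U g].

Lemma J1_openT : J1_open setT.
Proof. by move=> f _; exists 1. Qed.

Lemma J1_openI : setI_closed J1_open.
Proof.
move=> U V oU oV f [/oU[e e0 Ue] /oV[e' e'0 Ve']].
exists (Num.min e e'); first by rewrite lt_min e0.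
by move=> g; rewrite lt_min => /andP[/Ue ? /Ve'].
Qed.

Lemma J1_open_bigU (I : Type) (U : I -> set (cadlag R)) :
  (forall i, J1_open (U i)) -> J1_open (\bigcup_i U i).
Proof.
move=> oU f [i _ /oU[e e0 Ue]]; exists e => // g /Ue Ug.
by exists i.
Qed.

HB.instance Definition _ :=
  isOpenTopological.Build (cadlag R) J1_openT J1_openI J1_open_bigU.

(* The Borel sigma-algebra of the J_1 topology. *)
HB.instance Definition _ :=
  @isMeasurable.Build (sigma_display (@open (cadlag R))) (cadlag R)
    <<s @open (cadlag R) >> (@sigma_algebra0 _ setT _) (@sigma_algebraC _ _)
    (@sigma_algebra_bigcup _ setT _).

End J1_topology.

Record J1_metric (R : realType) (d : cadlag R -> cadlag R -> R) : Prop :=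
  J1Metric {
  J1_metric_ge0 : forall f g, 0 <= d f g ;
  J1_metric_eq0 : forall f g, d f g = 0 <-> f = g ;
  J1_metric_sym : forall f g, d f g = d g f ;
  J1_metric_triangle : forall f g h, d f h <= d f g + d g h ;
  J1_metric_complete : forall u : nat -> cadlag R,
    (forall e, 0 < e -> exists N, forall m n,
       (N <= m)%N -> (N <= n)%N -> d (u m) (u n) < e) ->
    exists f, d (u n) f @[n --> \oo] --> 0 ;
  J1_metric_open : forall U : set (cadlag R),
    open U <-> (forall f, U f ->
      exists2 e : R, 0 < e & forall g, d f g < e -> U g) ;
  J1_metric_sup_norm : exists C, forall f, d f (cadlag0 R) <= C * sup_norm f }.

Record filtered_process (R : realType) := FilteredProcess {
  fp_disp : measure_display ;
  fp_space : measurableType fp_disp ;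
  fp_prob : probability fp_space R ;
  fp_filt : R -> set (set fp_space) ;
  fp_filt_sigma : forall t, 0 <= t <= 1 -> sigma_algebra setT (fp_filt t) ;
  fp_filt_sub : forall t, 0 <= t <= 1 -> fp_filt t `<=` measurable ;
  fp_filt_mono : forall s t, 0 <= s -> s <= t -> t <= 1 ->
    fp_filt s `<=` fp_filt t ;
  fp_filt_right : forall t, 0 <= t < 1 ->
    \bigcap_(s in [set s | t < s <= 1]) fp_filt s `<=` fp_filt t ;
  fp_filt_complete : fp_prob.-negligible `<=` fp_filt 0 ;
  fp_proc : fp_space -> cadlag R ;
  fp_adapted : forall t, 0 <= t <= 1 ->
    preimage_set_system setT (fun w => fp_proc w t) measurable
      `<=` fp_filt t }.
Arguments fp_filt {R} X t : rename.
Arguments fp_proc {R} X w : rename.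

Definition FP (R : realType) (d : cadlag R -> cadlag R -> R) (p : R)
    (X : filtered_process R) : Prop :=
  ('E_(fp_prob X)[fun w => (d (cadlag0 R) (fp_proc X w) `^ p)%R] < +oo)%E.

Section conditional_independence.
Context {d} {T : measurableType d} {R : realType} (P : probability T R).

(* f is a version of the conditional probability P(A | G). *)
Definition cond_prob_version (G : set (set T)) (A : set T) (f : T -> R) :=
  [/\ preimage_set_system setT f measurable `<=` G,
      P.-integrable setT (EFin \o f) &
      forall C, G C -> (\int[P]_(w in C) (f w)%:E = P (A `&` C))%E].

Definition cond_indep (H1 H2 G : set (set T)) : Prop :=
  forall A B, H1 A -> H2 B -> exists f g h,
    [/\ cond_prob_version G A f, cond_prob_version G B g,
        cond_prob_version G (A `&` B) h &
        {ae P, forall w, h w = f w * g w}].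

End conditional_independence.

Section adapted_wasserstein.
Variable R : realType.
Implicit Types X Y : filtered_process R.

Definition coupling X Y : set (probability (fp_space X * fp_space Y)%type R) :=
  [set pi | (forall A, measurable A -> pushforward pi fst A = fp_prob X A) /\
            (forall B, measurable B -> pushforward pi snd B = fp_prob Y B)].
Arguments coupling X Y : clear implicits.

(* The projections x and y are parameters so that both directions of
   causality can be stated under the same measure. *)
Definition causal X Y d (T : measurableType d) (pi : probability T R)
    (x : T -> fp_space X) (y : T -> fp_space Y) (eps : R) : Prop :=
  forall t, 0 <= t <= 1 ->
    cond_indep pi (preimage_set_system setT y (fp_filt Y t))
                  (preimage_set_system setT x (fp_filt X 1))
                  (preimage_set_system setT x
                     (fp_filt X (Num.min (t + eps) 1))).

Arguments causal X Y {d T} pi x y eps.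

Definition Cpl_bc (eps : R) X Y
    : set (probability (fp_space X * fp_space Y)%type R) :=
  [set pi | [/\ coupling X Y pi, causal X Y pi fst snd eps &
                causal Y X pi snd fst eps]].
Arguments Cpl_bc eps X Y : clear implicits.

Definition AW (d : cadlag R -> cadlag R -> R) (p : R) X Y : \bar R :=
  ereal_inf
    [set ereal_inf
       [set (('E_pi[fun w => (d (fp_proc X w.1) (fp_proc Y w.2) `^ p)%R])
               `^ p^-1 + eps%:E)%E
       | pi in Cpl_bc eps X Y]
    | eps in [set eps : R | 0 <= eps]].

Definition stopping_time X : set (fp_space X -> R) :=
  [set tau | (forall w, 0 <= tau w <= 1) /\
             (forall t, 0 <= t <= 1 -> fp_filt X t [set w | tau w <= t])].
Arguments stopping_time X : clear implicits.

Definition path_time : set (cadlag R * R) := setT `*` `[0, 1].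

Definition non_anticipative (phi : cadlag R * R -> R) : Prop :=
  forall (f g : cadlag R) (t : R), 0 <= t <= 1 ->
    (forall s, 0 <= s <= t -> f s = g s) -> phi (f, t) = phi (g, t).

Definition OS X (phi : cadlag R * R -> R) : \bar R :=
  ereal_inf
    [set 'E_(fp_prob X)[fun w => phi (fp_proc X w, tau w)]%E
    | tau in stopping_time X].

End adapted_wasserstein.
Arguments path_time R : clear implicits.

(* Main.v *)
Require Import Defs.
From HB Require Import structures.
From mathcomp Require Import all_boot all_order all_algebra.
From mathcomp Require Import all_classical all_reals all_analysis.
From mathcomp Require Import measurable_realfun ring lra.

Set Implicit Arguments.
Unset Strict Implicit.
Unset Printing Implicit Defensive.

Import Order.TTheory GRing.Theory Num.Theory.
Import numFieldNormedType.Exports.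

Local Open Scope classical_set_scope.
Local Open Scope ring_scope.

(** Let X and Y be coupled by a bicausal coupling with delay eps, and let tau be
    a stopping time of X. Seen from Y, tau is a randomised stopping time that is
    revealed with delay eps: by causality the conditional distribution function
    Z q = P(tau <= q | Y) is known to Y at time q + eps (causal_delayed_cdf).
    Its quantiles at a uniform level u that is independent of Y, delayed by eps,
    are genuine stopping times of Y, and integrating over u gives
      OS(Y) <= E[phi(Y, tau + eps)]
    under the coupling (OS_le_randomized, OS_le_causal). It remains to compare
    the right-hand side with E[phi(X, tau)].

    For continuous phi, let X be the limit process and Y one of the X^n, or the
    converse. Since [0, 1] is compact and the law of X is fixed, the oscillation
    of phi near (X, t) is small uniformly in t outside an event of small
    probability (oscillating_small). Hence the two expectations differ by little
    whichever of the two processes carries the stopping time (close_OS).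

    For merely measurable phi the delay has to vanish before phi is applied. The
    probability spaces carry no topology, so couplings need not converge; but
    the distribution functions Z do, in the following sense. Those that come
    from couplings with small delay and small distance satisfy a decreasing
    sequence of convex constraints, and minimising a quadratic energy under
    these constraints produces a sequence that converges almost surely at all
    rational times simultaneously (exists_ae_cvg_sequence). The limit has no
    delay because the filtration is right-continuous, and inequalities on closed
    sets of paths force the pair (Y, quantile of Z) to have the law of (X, tau)
    (exists_limit_cdf). Hence OS(Y) <= E[phi(X, tau)] for every tau, and
    symmetrically.

    All this needs paths to be random variables for the Borel sets of the J1
    topology although the filtrations only see coordinates. Every path is the
    J1 limit of step paths that take countably many values and are read off
    finitely many coordinates (skorokhod_discretize), which settles this
    question and the joint measurability of the distance between two paths. *)

(** * Integration over sub-sigma-algebras *)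

Definition sub_measurable {T : Type} {R : realType} (G : set (set T))
  (f : T -> R) := forall B, measurable B -> G (f @^-1` B).

Section sub_sigma_algebra.
Context {d} {T : measurableType d} {R : realType}.
Variable G : set (set T).
Hypothesis sG : sigma_algebra setT G.

Lemma sub_measurableP (f : T -> R) :
  sub_measurable G f <->
  measurable_fun setT (f : g_sigma_algebraType G -> R).
Proof.
split=> [Gf _ B mB|mf B mB].
  by rewrite setTI /measurable /= sigma_algebra_id //; exact: Gf.
have /= := mf measurableT B mB.
by rewrite setTI {1}/measurable /= sigma_algebra_id.
Qed.

Lemma sub_measurable_gt (f : T -> R) :
  (forall c, G [set w | c < f w]) -> sub_measurable G f.
Proof.
move=> Gf; apply/sub_measurableP.
apply: (measurability (@RGenOInfty.G R)).
  exact: RGenOInfty.measurableE.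
move=> _ [_ [c ->] <-]; rewrite setTI /measurable /= sigma_algebra_id //.
by rewrite (_ : _ @^-1` _ = [set w | c < f w]) //; apply/seteqP; split=> w /=;
  rewrite in_itv /= andbT.
Qed.

End sub_sigma_algebra.

Section unif.
Variable R : realType.
Definition unif : probability (measurableTypeR R) R := uniform_prob (@ltr01 R).

Lemma unif_lt (c : R) : 0 <= c <= 1 -> unif [set u | u < c] = c%:E.
Proof.
move=> /andP[c0 c1].
have -> : [set u | u < c] = `]-oo, c[%classic.
  by apply/seteqP; split=> u /=; rewrite in_itv.
rewrite /unif /= /uniform_prob integral_uniform_pdf.
have -> : `]-oo, c[%classic `&` `[0, 1]%classic = `[0, c[%classic :> set R.
  apply/seteqP; split=> u /=; rewrite !in_itv /=.
    by move=> [-> /andP[-> _]].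
  by move=> /andP[-> uc]; rewrite uc /= (le_trans (ltW uc)).
rewrite (eq_integral (fun=> 1%:E)); last first.
  move=> u; rewrite inE /= in_itv /= /uniform_pdf => /andP[-> uc].
  by rewrite (le_trans (ltW uc) c1) /= subr0 invr1.
rewrite integral_cst //= mul1e lebesgue_measure_itv /= lte_fin.
case: ifPn; first by rewrite -EFinB subr0.
rewrite -leNgt => c0'; have -> // : c = 0.
by apply/le_anti; rewrite c0 c0'.
Qed.

End unif.

Lemma measurable_subgraph {d} {T : measurableType d} {R : realType}
  (f : T -> R) : measurable_fun setT f ->
  measurable [set z : T * measurableTypeR R | z.2 < f z.1].
Proof.
move=> mf; rewrite -[X in measurable X]setTI.
apply: (@measurable_fun_ltr _ _ _ setT (snd : T * measurableTypeR R -> R) (f \o fst)) => //.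
  exact: measurableT_comp.
Qed.

(** Tonelli, after writing f w as the length of [0, f w[. It reduces integrals
    against f to the events {u < f}. *)
Lemma layer_cake {d} {T : measurableType d} {R : realType}
  (P : probability T R) (f g : T -> R) :
  measurable_fun setT f -> (forall w, 0 <= f w <= 1) ->
  measurable_fun setT g -> (forall w, 0 <= g w) ->
  (\int[P]_w (f w * g w)%:E =
   \int[unif R]_u \int[P]_(w in [set w | (u < f w)%R]) (g w)%:E)%E.
Proof.
move=> mf f01 mg g0.
pose A := [set z : T * measurableTypeR R | z.2 < f z.1].
have mA : measurable A by exact: measurable_subgraph.
pose F z := (\1_A z * g z.1)%:E.
have mF : measurable_fun setT F.
  apply/measurable_EFinP/measurable_funM => //.
  exact: measurableT_comp.
have := @fubini_tonelli _ _ _ _ R P (unif R) F mF.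
move=> /(_ _)/wrap[].
  by move=> z; rewrite lee_fin mulr_ge0.
rewrite (eq_integral (fun w => (f w * g w)%:E)); last first.
  move=> w _.
  rewrite /F (eq_integral (fun u => (g w)%:E * (\1_(xsection A w) u)%:E)%E);
    last first.
    by move=> u _; rewrite -EFinM mulrC /= !indicE mem_xsection.
  rewrite ge0_integralZl//.
  - rewrite integral_indic //; last exact: measurable_xsection.
    rewrite setIT.
    have -> : xsection A w = [set u | u < f w].
      by apply/seteqP; split=> u /=; rewrite /xsection /= inE.
    by rewrite mulrC EFinM; congr (_ * _)%E; exact: unif_lt.
  - by apply/measurable_EFinP; apply: measurable_indic; exact: measurable_xsection.
  - by rewrite lee_fin.
move=> ->; apply: eq_integral => u _; rewrite [RHS]integral_mkcond.
apply: eq_integral => w _; rewrite /F patchE /= indicE /A.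
have [uf|uf] := boolP (u < f w).
  by rewrite !mem_set //= mul1r.
by rewrite !memNset /= ?mul0r //; exact/negP.
Qed.

(** Turns the integral of f over B into the probability of an event on an
    extended space, to which uniqueness of measures applies. *)
Lemma product_unif_subgraph {d} {T : measurableType d} {R : realType}
  (P : probability T R) (f : T -> R) (B : set T) : (forall w, 0 <= f w <= 1) ->
  ((P \x unif R) ([set z | B z.1] `&` [set z | (z.2 < f z.1)%R]) =
   \int[P]_(w in B) (f w)%:E)%E.
Proof.
move=> f01; rewrite /product_measure1 /= [RHS]integral_mkcond.
apply: eq_integral => w _ /=; rewrite patchE.
have [Bw|nBw] := pselect (B w).
  rewrite mem_set // (_ : xsection _ _ = [set u | u < f w]); first exact: unif_lt.
  by apply/seteqP; split=> u /=; rewrite /xsection /= inE //= => -[].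
rewrite memNset // (_ : xsection _ _ = set0) ?measure0 //.
by apply/seteqP; split=> u //=; rewrite /xsection /= inE //= => -[].
Qed.

Section conditional_probability.
Context {d} {T : measurableType d} {R : realType} (P : probability T R).
Variable G : set (set T).
Hypothesis sG : sigma_algebra setT G.
Hypothesis GT : G `<=` measurable.

Lemma sub_measurable_measurable (f : T -> R) :
  sub_measurable G f -> measurable_fun setT f.
Proof. by move=> Gf _ B mB; rewrite setTI; apply: GT; exact: Gf. Qed.

Lemma sub_measurable_lt (f g : T -> R) :
  sub_measurable G f -> sub_measurable G g -> G [set w | f w < g w].
Proof.
move=> /(sub_measurableP sG) mf /(sub_measurableP sG) mg.
have := measurable_fun_ltr mf mg measurableT (Y := [set true]).
move=> /(_ _)/wrap[] //; rewrite setTI {1}/measurable /= sigma_algebra_id //.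
Qed.

(** The set where g < f belongs to G, so the hypothesis applies to it and makes
    it a null set. *)
Lemma ae_le_of_le_integral (f g : T -> R) :
  sub_measurable G f -> sub_measurable G g ->
  P.-integrable setT (EFin \o f) -> P.-integrable setT (EFin \o g) ->
  (forall C, G C -> \int[P]_(w in C) (f w)%:E <= \int[P]_(w in C) (g w)%:E)%E ->
  {ae P, forall w, f w <= g w}.
Proof.
move=> Gf Gg If Ig fg.
pose C := [set w | g w < f w].
have GC : G C by exact: sub_measurable_lt.
have mC : measurable C by exact: GT.
have mf := sub_measurable_measurable Gf; have mg := sub_measurable_measurable Gg.
have IfC : P.-integrable C (EFin \o f) by exact: integrableS If.
have IgC : P.-integrable C (EFin \o g) by exact: integrableS Ig.
have le0 : (\int[P]_(w in C) ((f w)%:E - (g w)%:E) <= 0)%E.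
  rewrite integralB // sube_le0; exact: fg.
have eq0 : (\int[P]_(w in C) `|(f w - g w)%:E| = 0)%E.
  apply/eqP; rewrite eq_le integral_ge0 // andbT.
  rewrite (le_trans _ le0) //.
  rewrite (eq_integral (fun w => (f w)%:E - (g w)%:E)%E) //.
  move=> w; rewrite inE => Cw; rewrite gee0_abs // lee_fin subr_ge0; exact: ltW.
have mfg : measurable_fun C (fun w => (f w - g w)%:E).
  by apply/measurable_EFinP; apply: measurable_funTS; exact: measurable_funB.
have [+ _] := ae_eq_integral_abs P mC mfg.
move=> /(_ eq0) [N [mN N0 CN]].
exists N; split => // w /= /negP; rewrite -ltNge => Cw; apply: CN => /= /(_ Cw).
by move=> []; apply/eqP; rewrite subr_eq0 gt_eqF.
Qed.

Lemma cond_prob_version_ge0 A f : cond_prob_version P G A f ->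
  {ae P, forall w, 0 <= f w}.
Proof.
move=> [fG fi fA].
have Gf : sub_measurable G f.
  by move=> B mB; apply: fG; exists B => //; rewrite setTI.
have G0 : sub_measurable G (cst (0 : R)).
  by apply/sub_measurableP => //; exact: measurable_cst.
apply: ae_le_of_le_integral => //.
  exact: integrable0.
by move=> C GC; rewrite integral0 fA.
Qed.

End conditional_probability.

(** * Conditional independence and causality *)

Section conditional_independence_density.
Context {d} {T : measurableType d} {R : realType} (P : probability T R).
Variable G : set (set T).
Hypothesis sG : sigma_algebra setT G.
Hypothesis GT : G `<=` measurable.

(** The pull-out property of conditional probabilities. The layer cake formula
    reduces it to the events {u < f}, which belong to G. *)
Lemma integral_mul_cond_prob (f g : T -> R) B : measurable B ->
  sub_measurable G f -> (forall w, 0 <= f w <= 1) ->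
  cond_prob_version P G B g ->
  (\int[P]_w (f w * g w)%:E = \int[P]_(w in B) (f w)%:E)%E.
Proof.
move=> mB Gf f01 gB; have g_ge0 := cond_prob_version_ge0 sG GT gB.
case: gB => gG gi gB.
have Gg : sub_measurable G g.
  by move=> C mC; apply: gG; exists C => //; rewrite setTI.
have mf := sub_measurable_measurable GT Gf.
have mg := sub_measurable_measurable GT Gg.
pose g' w := Num.max (g w) 0.
have mg' : measurable_fun setT g' by exact: measurable_maxr.
have gg' : {ae P, forall w, g w = g' w}.
  by apply: filterS g_ge0 => w g0; rewrite /g' max_l.
transitivity (\int[P]_w (f w * g' w)%:E)%E.
  apply: ae_eq_integral => //.
  - by apply/measurable_EFinP; exact: measurable_funM.
  - by apply/measurable_EFinP; exact: measurable_funM.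
  - by apply: filterS gg' => w -> _.
have -> : (\int[P]_(w in B) (f w)%:E = \int[P]_w (f w * \1_B w)%:E)%E.
  rewrite integral_mkcond; apply: eq_integral => w _; rewrite patchE indicE.
  by case: ifPn => _; rewrite ?mulr1 ?mulr0.
rewrite layer_cake //; last by move=> w; rewrite /g' le_max lexx orbT.
rewrite layer_cake //.
apply: eq_integral => u _; set C := [set w | _].
have GC : G C.
  rewrite (_ : C = f @^-1` `]u, +oo[%classic); first exact: Gf.
  by apply/seteqP; split=> w /=; rewrite in_itv /= andbT.
have mC : measurable C by exact: GT.
rewrite integral_indic //.
transitivity (\int[P]_(w in C) (g w)%:E)%E; last exact: gB.
apply: ae_eq_integral => //.
- by apply/measurable_EFinP; exact: measurable_funTS.
- by apply/measurable_EFinP; exact: measurable_funTS.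
- by apply: filterS gg' => w ->.
Qed.

(** Any version f of P(A | G) is such a density, since
    P(A B) = E[P(A | G) P(B | G)] = E[f 1_B]. The versions provided for
    different B agree almost surely, and one of them is clamped to [0, 1]. *)
Lemma cond_indep_density H1 H2 A :
  H1 `<=` measurable -> H2 `<=` measurable -> H2 set0 ->
  cond_indep P H1 H2 G -> H1 A ->
  exists f : T -> R, [/\ sub_measurable G f, forall w, 0 <= f w <= 1 &
    forall B, H2 B -> (\int[P]_(w in B) (f w)%:E = P (A `&` B))%E].
Proof.
move=> mH1 mH2 H20 ci H1A.
have [f0 [_ [_ [f0A _ _ _]]]] := ci _ _ H1A H20.
have f0_ge0 := cond_prob_version_ge0 sG GT f0A.
have Gv A' f : cond_prob_version P G A' f -> sub_measurable G f.
  by case=> fG _ _ B mB; apply: fG; exists B => //; rewrite setTI.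
have Gf0 := Gv _ _ f0A.
have G1 : sub_measurable G (cst (1 : R)).
  by apply/sub_measurableP => //; exact: measurable_cst.
have f0_le1 : {ae P, forall w, f0 w <= 1}.
  apply: (@ae_le_of_le_integral _ _ _ P G sG GT f0 (cst 1)) => //.
  - by case: f0A.
  - exact: finite_measure_integrable_cst.
  - move=> C GC; case: f0A => _ _ ->//.
    have -> : (\int[P]_(w in C) (cst 1 w)%:E = P C)%E.
      by rewrite [LHS](integral_cst P (GT GC) 1%E) mul1e.
    apply: le_measure; rewrite ?inE; last by [].
      by apply: measurableI; [exact: mH1|exact: GT].
    exact: GT.
pose f w := Num.max 0 (Num.min (f0 w) 1).
have f0f : {ae P, forall w, f0 w = f w}.
  apply: filterS2 f0_ge0 f0_le1 => w f0w0 f0w1.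
  by rewrite /f min_l // max_r.
have Gf : sub_measurable G f.
  apply/sub_measurableP => //; apply: measurable_maxr => //.
  by apply: measurable_minr => //; exact/sub_measurableP.
have f01 w : 0 <= f w <= 1.
  by rewrite /f le_max lexx /= ge_max ler01 ge_min lexx orbT.
exists f; split=> // B H2B.
have [f1 [g [h [f1A gB hAB hfg]]]] := ci _ _ H1A H2B.
have f10 : {ae P, forall w, f1 w = f0 w}.
  have := f1A; have := f0A.
  move=> [_ f0i f0C] [_ f1i f1C].
  have le10 : {ae P, forall w, f1 w <= f0 w}.
    apply: (@ae_le_of_le_integral _ _ _ P G sG GT f1 f0) => //.
      exact: Gv f1A.
    by move=> C GC; rewrite f1C // f0C.
  have le01 : {ae P, forall w, f0 w <= f1 w}.
    apply: (@ae_le_of_le_integral _ _ _ P G sG GT f0 f1) => //.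
      exact: Gv f1A.
    by move=> C GC; rewrite f1C // f0C.
  by apply: filterS2 le10 le01 => w h1 h2; apply/le_anti; rewrite h1.
rewrite -(integral_mul_cond_prob _ Gf f01 gB); last exact: mH2.
have [_ _ hC] := hAB.
have := hC setT; rewrite setIT => <-; last first.
  by case: sG => G0 GC _; rewrite -[setT]setD0; exact: GC.
have mf := sub_measurable_measurable GT Gf.
have mg := sub_measurable_measurable GT (Gv _ _ gB).
have mh := sub_measurable_measurable GT (Gv _ _ hAB).
apply: ae_eq_integral => //.
- by apply/measurable_EFinP; exact: measurable_funM.
- exact/measurable_EFinP.
- by apply: filterS3 hfg f10 f0f => w -> -> -> _.
Qed.

End conditional_independence_density.

Section causal_density.
Context {R : realType} (X Y : filtered_process R).
Context {d} {T : measurableType d} (pi : probability T R).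
Variables (x : T -> fp_space X) (y : T -> fp_space Y) (s : fp_space Y -> T).
Hypothesis mx : measurable_fun setT x.
Hypothesis my : measurable_fun setT y.
Hypothesis ys : forall v, y (s v) = v.
Hypothesis piy : forall B, measurable B -> pushforward pi y B = fp_prob Y B.

(** Such an f is constant on the fibres of y, hence factors through the
    section s. *)
Lemma preimage_sub_measurable F (f : T -> R) :
  sub_measurable (preimage_set_system setT y F) f ->
  sub_measurable F (f \o s) /\ forall w, f w = f (s (y w)).
Proof.
move=> Gf; split=> [B mB|w].
  have [D FD yD] := Gf _ mB.
  rewrite comp_preimage -yD setTI -comp_preimage.
  by rewrite (_ : y \o s = id) //; apply/funext => v /=.
have [D FD yD] := Gf _ (measurable_set1 (f w)).
have : (f @^-1` [set f w]) w by [].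
rewrite -yD => -[_ Dw].
have : (f @^-1` [set f w]) (s (y w)) by rewrite -yD; split => //=; rewrite ys.
by move=> /= ->.
Qed.

(** Given the whole of Y, the conditional probability of an event known to X at
    time t is known to Y at time t + eps. *)
Lemma causal_density eps t A :
  0 <= eps -> 0 <= t <= 1 -> causal pi y x eps -> fp_filt X t A ->
  exists rho : fp_space Y -> R,
    [/\ sub_measurable (fp_filt Y (Num.min (t + eps) 1)) rho,
        forall v, 0 <= rho v <= 1 &
        forall B, fp_filt Y 1 B ->
          (\int[fp_prob Y]_(v in B) (rho v)%:E =
           pi (x @^-1` A `&` y @^-1` B))%E].
Proof.
move=> eps0 t01 /(_ t t01) ci FA.
have /andP[t0 t1] := t01.
have u01 : 0 <= Num.min (t + eps) 1 <= 1.
  by rewrite ge_min lexx orbT le_min ler01 addr_ge0.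
have mpre (Z : filtered_process R) (z : T -> fp_space Z) r :
    measurable_fun setT z -> 0 <= r <= 1 ->
    preimage_set_system setT z (fp_filt Z r) `<=` measurable.
  move=> mz r01 _ [D FD <-]; apply: mz => //.
  exact: (@fp_filt_sub _ Z _ r01).
have I1 : 0 <= (1 : R) <= 1 by rewrite ler01 lexx.
have [] := @cond_indep_density _ _ _ pi
  (preimage_set_system setT y (fp_filt Y (Num.min (t + eps) 1))) _ _
  (preimage_set_system setT x (fp_filt X t))
  (preimage_set_system setT y (fp_filt Y 1)) (x @^-1` A) _ _ _ ci _.
- by apply: sigma_algebra_preimage; exact: fp_filt_sigma.
- exact: mpre.
- exact: mpre.
- exact: mpre.
- by exists set0; [case: (@fp_filt_sigma _ Y _ I1) | rewrite preimage_set0 setI0].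
- by exists A => //; rewrite setTI.
move=> f [Gf f01 fB].
have [Frho fs] := preimage_sub_measurable Gf.
exists (f \o s); split => [//|v|B FB]; first exact: f01.
rewrite -fB; last by exists B => //; rewrite setTI.
have mB : measurable B by exact: (@fp_filt_sub _ Y _ I1).
have mrho : measurable_fun setT (f \o s).
  by apply: sub_measurable_measurable Frho; exact: (@fp_filt_sub _ Y _ u01).
rewrite (@eq_measure_integral _ _ _ B (pushforward pi y)); last first.
  by move=> C mC _; exact/esym/piy.
rewrite ge0_integral_pushforward //.
- by apply: eq_integral => w _; rewrite /= -fs.
- by apply/measurable_EFinP; exact: measurable_funTS.
- by move=> v _; rewrite lee_fin /=; case/andP: (f01 (s v)).
Qed.

End causal_density.

(** * Step approximations in the J1 topology *)

Section step_paths.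
Variable R : realType.

Lemma clamp01_id (t : R) : 0 <= t <= 1 -> clamp01 t = t.
Proof. by move=> /andP[t0 t1]; rewrite /clamp01 min_l // max_r. Qed.

Lemma clamp01_itv (t : R) : 0 <= clamp01 t <= 1.
Proof. by rewrite /clamp01 le_max lexx /= ge_max ler01 ge_min lexx orbT. Qed.

Lemma truncn_is_cadlag (a : R) (h : nat -> R) : 0 < a ->
  is_cadlag (fun t => h (Num.truncn (a * clamp01 t))).
Proof.
move=> a0; split=> [t /andP[t0 t1]|t /andP[t0 t1]].
  apply: cvg_near_cst; set n := Num.truncn (a * clamp01 t).
  have at0 : 0 <= a * t by rewrite mulr_ge0 // ltW.
  have nE : n = Num.truncn (a * t) by rewrite /n clamp01_id // t0 ltW.
  have /andP[nl nr] := truncn_itv at0; rewrite -nE in nl nr.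
  near=> s; congr h; apply: truncn_def.
  have ts : t < s by near: s; exact: nbhs_right_gt.
  have s1 : s < 1 by near: s; exact: nbhs_right_lt.
  rewrite clamp01_id; last by rewrite (le_trans t0 (ltW ts)) ltW.
  rewrite (le_trans nl) /=; last by rewrite ler_pM2l // ltW.
  rewrite -ltr_pdivlMl //; near: s; apply: nbhs_right_lt.
  by rewrite ltr_pdivlMl.
have at0 : 0 < a * t by rewrite mulr_gt0.
suff [m /andP[ml mr]] : exists m : nat, m%:R < a * t <= m.+1%:R.
  apply/cvg_ex; exists (h m); apply: cvg_near_cst.
  near=> s; congr h; apply: truncn_def.
  have st : s < t by near: s; exact: nbhs_left_lt.
  have s0 : 0 < s by near: s; exact: nbhs_left_gt.
  rewrite clamp01_id; last by rewrite (ltW s0) (le_trans (ltW st) t1).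
  rewrite (lt_le_trans _ mr) ?ltr_pM2l // andbT; apply: ltW.
  rewrite -ltr_pdivrMl //; near: s; apply: nbhs_left_gt.
  by rewrite ltr_pdivrMl.
have /andP[nl nr] := truncn_itv (ltW at0).
move: nl; rewrite le_eqVlt => /predU1P[nE|nl]; last first.
  by exists (Num.truncn (a * t)); rewrite nl ltW.
have : (0 < Num.truncn (a * t))%N by rewrite -(ltr_nat R) nE.
case E : (Num.truncn (a * t)) => [//|m] _; exists m.
by rewrite -nE E lexx ltr_nat ltnSn.
Unshelve. all: by end_near. Qed.

(** Integer codes make the step paths of a given mesh countable. *)
Definition step_path (k : nat) (c : seq int) : cadlag R.
Proof.
apply: (@Cadlag R (fun t =>
  (nth 0 c (Num.truncn (k.+1%:R * clamp01 t)))%:~R / k.+1%:R)).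
  exact: (truncn_is_cadlag (fun n => (nth 0 c n)%:~R / k.+1%:R)).
by move=> t; rewrite [clamp01 (clamp01 t)]clamp01_id // clamp01_itv.
Defined.

Definition path_code (k : nat) (f : cadlag R) : seq int :=
  mkseq (fun i => Num.floor (k.+1%:R * f (i%:R / k.+1%:R))) k.+2.

Definition discretize (k : nat) (f : cadlag R) : cadlag R :=
  step_path k (path_code k f).

Lemma discretize_near k (f : cadlag R) t : 0 <= t <= 1 ->
  `|f ((Num.truncn (k.+1%:R * t))%:R / k.+1%:R) - discretize k f t|
    <= k.+1%:R^-1.
Proof.
move=> t01; have /andP[t0 t1] := t01; rewrite /discretize /= clamp01_id //.
set n : R := k.+1%:R; have n0 : 0 < n by rewrite ltr0n.
set j := Num.truncn _; have jn : (j < k.+2)%N.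
  rewrite ltnS -ltnS truncn_lt_nat; last by rewrite mulr_ge0 // ltW.
  by rewrite (le_lt_trans (y := n)) ?ltr_nat // -[leRHS]mulr1 ler_pM2l.
rewrite nth_mkseq //; set v := f _.
have /andP[l1 l2] := floor_itv (n * v).
have -> : v - (Num.floor (n * v))%:~R / n = (n * v - (Num.floor (n * v))%:~R) / n.
  by field; rewrite gt_eqF.
rewrite normrM [`|n^-1|]gtr0_norm ?invr_gt0 //.
apply: ler_piMl; first by rewrite invr_ge0 ltW.
rewrite ger0_norm ?subr_ge0 //.
by rewrite lerBlDl ltW // -intrD1.
Qed.

End step_paths.

Section skorokhod_approximation.
Variable R : realType.
Implicit Types f g : cadlag R.

Lemma sup_norm_le (u : R -> R) c :
  (forall t, 0 <= t <= 1 -> `|u t| <= c) -> sup_norm u <= c.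
Proof.
move=> uc; apply: ge_sup.
  by exists `|u 0|, 0 => //=; rewrite in_itv /= lexx ler01.
by move=> _ [t /= + <-]; rewrite in_itv /=; exact: uc.
Qed.

Lemma sup_norm_ge0 (u : R -> R) : 0 <= sup_norm u.
Proof.
have [hs|nhs] := pselect (has_sup [set `|u t| | t in `[0, 1]]); last first.
  by rewrite /sup_norm sup_out.
apply: (le_trans (normr_ge0 (u 0))); apply: ub_le_sup; first by case: hs.
by exists 0 => //=; rewrite in_itv /= lexx ler01.
Qed.

Lemma skorokhod_dist_le f g l e : time_changes l ->
  (forall t, 0 <= t <= 1 -> `|l t - t| <= e) ->
  (forall t, 0 <= t <= 1 -> `|f t - g (l t)| <= e) ->
  skorokhod_dist f g <= e.
Proof.
move=> tl le1 le2; apply: le_trans (_ : Num.max (sup_norm (fun t => l t - t))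
                   (sup_norm (fun t => f t - g (l t))) <= e); last first.
  by rewrite ge_max !sup_norm_le.
apply: ge_inf; last by exists l.
by exists 0 => _ [m _ <-]; rewrite le_max sup_norm_ge0.
Qed.

Let grid (n : nat) (a : R) : R := (Num.ceil (n.+1%:R * a))%:~R / n.+1%:R.

Let grid_itv n a : a <= grid n a < a + n.+1%:R^-1.
Proof.
have n0 : 0 < n.+1%:R :> R by rewrite ltr0n.
have /andP[h1 h2] := ceil_itv (n.+1%:R * a).
rewrite /grid ler_pdivlMr // mulrC h2 /= ltr_pdivrMr // mulrDl mulVf ?gt_eqF //.
by move: h1; rewrite intrB [a * _]mulrC; lra.
Qed.

(** Rounding down after the time change undoes the rounding up of the
    breakpoints a and b, which keeps the sampling point in the same piece of the
    path. *)
Let grid_between n a b v : 0 <= v -> grid n a <= v < grid n b ->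
  a <= (Num.truncn (n.+1%:R * v))%:R / n.+1%:R < b.
Proof.
move=> v0 /andP[av vb].
have n0 : 0 < n.+1%:R :> R by rewrite ltr0n.
have nv0 : 0 <= n.+1%:R * v by rewrite mulr_ge0 // ltW.
have /andP[j1 j2] := truncn_itv nv0; set j := Num.truncn _ in j1 j2 *.
apply/andP; split.
  rewrite ler_pdivlMr // mulrC (le_trans (ceil_ge _)) //.
  have -> : j%:R = (j%:Z)%:~R :> R by [].
  rewrite ler_int -ltzD1 -(@ltr_int R) intrD1.
  move: av; rewrite /grid ler_pdivrMr // [v * _]mulrC => /le_lt_trans; apply.
  by move: j2; rewrite -[j.+1%:R]natr1.
rewrite ltr_pdivrMr // mulrC.
have -> : j%:R = (j%:Z)%:~R :> R by [].
rewrite -ceil_gt_int -(@ltr_int R).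
by apply: le_lt_trans j1 _; move: vb; rewrite /grid ltr_pdivlMr // [v * _]mulrC.
Qed.

(** The time change l is defined on the whole line, so that it can be extended
    beyond a by a closed formula. *)
Let matched f (e : R) n a (l : R -> R) :=
  [/\ continuous l, {homo l : s t / s < t}, l 0 = 0 /\ l a = grid n a,
      forall t, 0 <= t <= a -> `|l t - t| <= n.+1%:R^-1 &
      forall t, 0 <= t < a ->
        `|f t - f ((Num.truncn (n.+1%:R * l t))%:R / n.+1%:R)| <= e].

(** The path oscillates by at most e on [a, b[, so every time change from this
    interval to [grid a, grid b[ is suitable there; a linear piece is glued to
    l at a. Its slope is positive because the mesh is smaller than b - a. *)
Let matched_extend f e n a b l : 0 <= a -> n.+1%:R^-1 < b - a ->
  (forall s t, a <= s < b -> a <= t < b -> `|f s - f t| <= e) ->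
  matched f e n a l -> exists l', matched f e n b l'.
Proof.
move=> a0 nab osc [cl hl [l0 la] lid lf].
have n0 : 0 < n.+1%:R^-1 :> R by rewrite invr_gt0 ltr0n.
have ab : 0 < b - a by exact: lt_trans nab.
have /andP[a1 a2] := grid_itv n a; have /andP[b1 b2] := grid_itv n b.
pose m := (grid n b - grid n a) / (b - a).
have m0 : 0 < m by rewrite divr_gt0 // subr_gt0 (lt_trans a2) // (lt_le_trans _ b1) // -ltrBrDl.
have mab : m * (b - a) = grid n b - grid n a by rewrite /m divfK // gt_eqF.
pose l' t := l (Num.min t a) + m * Num.max 0 (t - a).
have l'l t : t <= a -> l' t = l t.
  by move=> ta; rewrite /l' min_l // max_l ?subr_le0 // mulr0 addr0.
have l'r t : a <= t -> l' t = grid n a + m * (t - a).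
  by move=> ta; rewrite /l' min_r // max_r ?subr_ge0 // la.
exists l'; split.
- move=> t; apply: cvgD.
    apply: (@continuous_comp _ _ _ (fun t => Num.min t a) l); last exact: cl.
    by apply: continuous_min => //; exact: cvg_cst.
  apply: cvgM; first exact: cvg_cst.
  apply: (@continuous_max _ _ (fun=> 0) (fun t => t - a)); first exact: cvg_cst.
  by apply: cvgB => //; exact: cvg_cst.
- have key s t : s < t -> a <= s -> l' s < l' t.
    move=> st sa; rewrite !l'r //; last exact: le_trans (ltW st).
    by rewrite ltrD2l ltr_pM2l // ltrD2r.
  move=> s t st; have [as_|sa] := leP a s; first exact: key.
  have [ta|at_] := leP t a; first by rewrite !l'l ?hl // ltW.
  rewrite l'l; last exact: ltW.
  by rewrite (lt_trans (hl _ _ sa)) // -l'l // key.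
- by rewrite l'l // l'r ?mab; [split => //; lra|lra].
- move=> t /andP[t0 tb]; have [ta|at_] := leP t a; first by rewrite l'l // lid // t0.
  rewrite l'r; last exact: ltW.
  have E : (grid n a + m * (t - a) - t) * (b - a) =
      (b - t) * (grid n a - a) + (t - a) * (grid n b - b).
    rewrite mulrBl mulrDl.
    have -> : m * (t - a) * (b - a) = (t - a) * (grid n b - grid n a).
      by rewrite -mab; ring.
    by ring.
  have bt0 : 0 <= b - t by rewrite subr_ge0.
  have ta0 : 0 <= t - a by rewrite subr_ge0 ltW.
  rewrite ger0_norm.
    rewrite -(ler_pM2r ab) E.
    rewrite (_ : _^-1 * _ = (b - t) * n.+1%:R^-1 + (t - a) * n.+1%:R^-1).
      by rewrite lerD // ler_wpM2l // lerBlDl ltW.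
    by rewrite -mulrDl mulrC; congr (_ * _); ring.
  rewrite -(pmulr_lge0 _ ab) E.
  by rewrite addr_ge0 // mulr_ge0 // subr_ge0.
- move=> t /andP[t0 tb]; have [ta|at_] := ltP t a.
    by rewrite l'l; [rewrite lf // t0|exact: ltW].
  apply: osc; first by rewrite at_.
  have gl : grid n a <= l' t by rewrite l'r // lerDl mulr_ge0 ?subr_ge0 // ltW.
  apply: grid_between; first by rewrite (le_trans _ gl) // (le_trans a0).
  rewrite gl l'r //=.
  have : m * (t - a) < m * (b - a) by rewrite ltr_pM2l // ltrD2r.
  by rewrite mab; lra.
Qed.

Let reachable f e : set R := [set a | 0 <= a <= 1 /\
  exists K, forall n, (K <= n)%N -> exists l, matched f e n a l].

Let reachable_extend f e a b : reachable f e a -> a < b -> b <= 1 ->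
  (forall s t, a <= s < b -> a <= t < b -> `|f s - f t| <= e) ->
  reachable f e b.
Proof.
move=> [/andP[a0 a1] [K Kl]] ab b1 osc; split; first by rewrite b1 (le_trans a0) // ltW.
have ba0 : 0 < b - a by rewrite subr_gt0.
exists (maxn K (Num.truncn (b - a)^-1)) => n; rewrite geq_max => /andP[/Kl[l ml] nba].
apply: matched_extend osc ml => //.
rewrite invf_plt ?posrE ?ltr0n //.
by rewrite (lt_le_trans (truncnS_gt _)) // ler_nat ltnS.
Qed.

(** Induction along the real line: the supremum of the reachable times is itself
    reachable because f has a left limit there, and if it were less than 1 then
    right-continuity of f would allow to go further. *)
Let reachable1 f e : 0 < e -> reachable f e 1.
Proof.
move=> e0.
have e20 : 0 < e / 2 by rewrite divr_gt0.
have near_osc (l s t : R) : `|l - f s| <= e / 2 -> `|l - f t| <= e / 2 ->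
    `|f s - f t| <= e.
  move=> h1 h2; rewrite (_ : f s - f t = (l - f t) - (l - f s)); last by ring.
  rewrite (le_trans (ler_normB _ _)) //.
  by rewrite (splitr e) lerD.
have S0 : reachable f e 0.
  split; first by rewrite lexx ler01.
  exists 0%N => n _; exists id; split => //.
  - by move=> t; exact: cvg_id.
  - by split=> //; rewrite /grid mulr0 ceil0 mul0r.
  - by move=> t _; rewrite subrr normr0 invr_ge0.
  - by move=> t /andP[/le_lt_trans/[apply]]; rewrite ltxx.
have hS : has_sup (reachable f e).
  by split; [exists 0|exists 1 => a [/andP[]]].
set s := sup (reachable f e).
have s0 : 0 <= s by apply: ub_le_sup => //; case: hS.
have s1 : s <= 1 by apply: ge_sup => [|a [/andP[]]//]; exists 0.
have Ss : reachable f e s.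
  move: s0; rewrite le_eqVlt => /predU1P[<-//|s0].
  have [_ /(_ s)] := cadlagP f; rewrite s0 s1 => /(_ isT) /cvg_ex[l /cvgrPdist_le].
  move=> /(_ _ e20) /nbhs_ballP[r /= r0 rl].
  have [a Sa ra] := sup_adherent r0 hS.
  have as_ : a <= s by apply: ub_le_sup => //; case: hS.
  move: as_; rewrite le_eqVlt => /predU1P[<-//|as_].
  apply: (reachable_extend Sa as_ s1) => u v /andP[au us] /andP[av vs].
  apply: (@near_osc l) => //; apply: rl => //; rewrite /ball /= ger0_norm ?subr_ge0 1?ltW //;
    by move: ra au av; rewrite -/s; lra.
move: s1; rewrite le_eqVlt => /predU1P[<-//|s1].
have [/(_ s) + _] := cadlagP f; rewrite s0 s1 => /(_ isT) /cvgrPdist_le.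
move=> /(_ _ e20) /nbhs_ballP[r /= r0 rl].
pose b := Num.min 1 (s + r).
have sb : s < b by rewrite /b lt_min s1 ltrDl.
suff Sb : reachable f e b.
  have : b <= s by apply: ub_le_sup => //; case: hS.
  by rewrite leNgt sb.
apply: (reachable_extend Ss sb).
  by rewrite /b ge_min lexx.
have near_s u : s <= u < b -> `|f s - f u| <= e / 2.
  move=> /andP[]; rewrite le_eqVlt => /predU1P[<- _|su ub].
    by rewrite subrr normr0 ltW.
  apply: rl => //; rewrite /ball /= ltr0_norm ?subr_lt0 //.
  by move: ub; rewrite /b lt_min => /andP[_]; lra.
by move=> u v us vs; apply: (@near_osc (f s)) => //; exact: near_s.
Qed.

Lemma skorokhod_discretize f e : 0 < e ->
  exists K, forall k, (K <= k)%N -> skorokhod_dist f (discretize k f) <= e.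
Proof.
move=> e0; have e20 : 0 < e / 2 by rewrite divr_gt0.
have [_ [K Kl]] := reachable1 f e20.
exists (maxn K (Num.truncn (e / 2)^-1)) => k; rewrite geq_max => /andP[/Kl[l]].
move=> [cl hl [l0 l1] lid lf] ek.
have {}l1 : l 1 = 1.
  have ck : Num.ceil (k.+1%:R : R) = k.+1%:Z by exact: (intrKceil k.+1%:Z).
  by rewrite l1 /grid mulr1 ck divff // pnatr_eq0.
have ke : k.+1%:R^-1 <= e / 2.
  rewrite invf_ple ?posrE ?ltr0n //.
  by rewrite ltW // (lt_le_trans (truncnS_gt _)) // ler_nat ltnS.
have mono : {homo l : s t / s <= t} by exact/ltW_homo.
have lt01 t : 0 <= t <= 1 -> 0 <= l t <= 1.
  by move=> /andP[t0 t1]; apply/andP; split; [rewrite -l0|rewrite -l1]; exact: mono.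
apply: (@skorokhod_dist_le _ _ l).
- split=> //; first exact: continuous_subspaceT.
  by move=> s t _ _; exact: hl.
- move=> t t01; rewrite (le_trans (lid _ t01)) // (le_trans ke) //.
  by rewrite ler_pdivrMr // ler_peMr ?ltW // ltr1n.
- move=> t t01; set g := discretize k f.
  pose v := f ((Num.truncn (k.+1%:R * l t))%:R / k.+1%:R).
  rewrite (_ : f t - g (l t) = (f t - v) + (v - g (l t))); last by ring.
  rewrite (splitr e) (le_trans (ler_normD _ _)) // lerD //; last first.
    by rewrite (le_trans _ ke) // discretize_near // lt01.
  case/andP: t01 => t0; rewrite le_eqVlt => /predU1P[t1|t1].
    by rewrite /v t1 l1 mulr1 natrK divff // subrr normr0 ltW.
  by rewrite lf // t0.
Qed.

End skorokhod_approximation.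

(** * Measurability of random paths *)

Section J1_measurability.
Variables (R : realType) (d : cadlag R -> cadlag R -> R).
Hypothesis d_J1 : J1_metric d.
Implicit Types f g : cadlag R.

Lemma J1_metric_refl f : d f f = 0.
Proof. exact/(J1_metric_eq0 d_J1). Qed.

Lemma open_J1_ball f e : open [set g | d f g < e].
Proof.
apply/(J1_metric_open d_J1) => g /= fg; exists (e - d f g).
  by rewrite subr_gt0.
by move=> h gh; rewrite (le_lt_trans (J1_metric_triangle d_J1 _ g _)) //; lra.
Qed.

(** Balls for d are J1-open, hence contain balls for the Skorokhod distance. *)
Lemma J1_metric_discretize f e : 0 < e ->
  exists K, forall k, (K <= k)%N -> d f (discretize k f) < e.
Proof.
move=> e0; have oB : J1_open [set g | d f g < e] by exact: open_J1_ball.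
have [|e' e'0 He'] := oB f; first by rewrite /= J1_metric_refl.
have e'2 : 0 < e' / 2 by rewrite divr_gt0.
have [K HK] := skorokhod_discretize f e'2.
exists K => k /HK Kk; apply: He'; apply: (le_lt_trans Kk); lra.
Qed.

Lemma J1_metric_lip f f' g g' : `|d f g - d f' g'| <= d f f' + d g g'.
Proof.
have := J1_metric_triangle d_J1 f f' g; have := J1_metric_triangle d_J1 f' g' g.
have := J1_metric_triangle d_J1 f' f g'; have := J1_metric_triangle d_J1 f g g'.
rewrite (J1_metric_sym d_J1 g' g) (J1_metric_sym d_J1 f' f).
by move=> *; rewrite ler_norml; apply/andP; split; lra.
Qed.

Section random_path.
Context {disp} {T : measurableType disp}.
Implicit Types Z : T -> cadlag R.

Definition coordinates_measurable Z :=
  forall t, 0 <= t <= 1 -> measurable_fun setT (fun w => Z w t).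

Lemma measurable_path_code Z k c : coordinates_measurable Z ->
  measurable [set w | path_code k (Z w) = c].
Proof.
move=> mZ; have n0 : 0 < k.+1%:R :> R by rewrite ltr0n.
have [sc|/eqP sc] := eqVneq (size c) k.+2; last first.
  rewrite (_ : mkset _ = set0) //; apply/seteqP; split=> // w /= wc.
  by case: sc; rewrite -wc size_mkseq.
rewrite (_ : mkset _ = \bigcap_(i in `I_(k.+2))
  [set w | Num.floor (k.+1%:R * Z w (i%:R / k.+1%:R)) = nth 0 c i]).
  apply: bigcap_measurable; first by exists 0%N.
  move=> i /= ik; set m := nth 0 c i.
  rewrite (_ : mkset _ = setT `&` (fun w => k.+1%:R * Z w (i%:R / k.+1%:R)) @^-1`
      `[m%:~R, (m + 1)%:~R[%classic).
    apply: measurable_funM => //; apply: mZ.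
    by rewrite divr_ge0 //= ler_pdivrMr // mul1r ler_nat -ltnS.
  rewrite setTI; apply/seteqP; split=> w /=; rewrite in_itv /=.
    by move=> <-; exact: floor_itv.
  by move=> /floor_def.
apply/seteqP; split=> w /=.
  by move=> <- i /= ik; rewrite nth_mkseq.
move=> H; apply: (@eq_from_nth _ 0); first by rewrite size_mkseq sc.
by move=> i; rewrite size_mkseq => ik; rewrite nth_mkseq //; exact: H.
Qed.

(** A discretised path takes countably many values, each on an event that is
    described by finitely many coordinates. *)
Lemma measurable_discretize2 Z Z' k (A : cadlag R -> cadlag R -> Prop) :
  coordinates_measurable Z -> coordinates_measurable Z' ->
  measurable [set w | A (discretize k (Z w)) (discretize k (Z' w))].
Proof.
move=> mZ mZ'.
rewrite (_ : mkset _ = \bigcup_c [set w | [/\ path_code k (Z w) = c.1,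
    path_code k (Z' w) = c.2 & A (step_path R k c.1) (step_path R k c.2)]]).
  apply: countable_bigcupT_measurable => [|[c c']] //=.
  have [Ac|nAc] := pselect (A (step_path R k c) (step_path R k c')); last first.
    by rewrite (_ : mkset _ = set0) //; apply/seteqP; split=> w // [].
  rewrite (_ : mkset _ = [set w | path_code k (Z w) = c] `&`
      [set w | path_code k (Z' w) = c']).
    by apply: measurableI; exact: measurable_path_code.
  by apply/seteqP; split=> w /= [].
apply/seteqP; split=> w /=.
  by move=> Aw; exists (path_code k (Z w), path_code k (Z' w)).
by move=> [[c c'] _ [/= cE c'E]]; rewrite /discretize cE c'E.
Qed.

Lemma measurable_J1_metric Z Z' :
  coordinates_measurable Z -> coordinates_measurable Z' ->
  measurable_fun setT (fun w => d (Z w) (Z' w)).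
Proof.
move=> mZ mZ'.
apply: (@measurable_fun_cvg _ _ _ setT (fun k w => d (discretize k (Z w)) (discretize k (Z' w)))).
  move=> k _ B mB; rewrite setTI.
  exact: (measurable_discretize2 k (fun f g => B (d f g)) mZ mZ').
move=> w _; apply/cvgrPdist_lt => e e0.
have e20 : 0 < e / 2 by rewrite divr_gt0.
have [K HK] := J1_metric_discretize (Z w) e20.
have [K' HK'] := J1_metric_discretize (Z' w) e20.
near=> k; rewrite (le_lt_trans (J1_metric_lip _ _ _ _)) // (splitr e) ltrD //.
  by apply: HK; near: k; exact: nbhs_infty_ge.
by apply: HK'; near: k; exact: nbhs_infty_ge.
Unshelve. all: by end_near. Qed.

(** A path belongs to an open set U if and only if, for some radius, its
    discretisations eventually have their ball of this radius inside U. *)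
Lemma measurable_random_path Z :
  coordinates_measurable Z -> measurable_fun setT Z.
Proof.
move=> mZ; apply: (@measurability _ _ _ _ setT Z (@open (cadlag R))) => //.
move=> _ [U oU <-]; rewrite setTI.
pose V m := [set g | forall h, d g h < m.+1%:R^-1 -> U h].
rewrite (_ : Z @^-1` U = \bigcup_m \bigcup_K \bigcap_(k in [set k | (K <= k)%N])
    [set w | V m (discretize k (Z w))]).
  apply: bigcupT_measurable => m; apply: bigcupT_measurable => K.
  apply: bigcap_measurable; first by exists K => /=.
  by move=> k _; exact: (measurable_discretize2 k (fun f _ => V m f) mZ mZ).
apply/seteqP; split=> w /=.
  move=> Uw; have [e e0 Ue] := (J1_metric_open d_J1 U).1 oU _ Uw.
  have e20 : 0 < e / 2 by rewrite divr_gt0.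
  pose m := Num.truncn (e / 2)^-1.
  have me : m.+1%:R^-1 <= e / 2.
    by rewrite invf_ple ?posrE ?ltr0n // ltW // truncnS_gt.
  have [K HK] := J1_metric_discretize (Z w) e20.
  exists m => //; exists K => // k /= /HK Kk h kh; apply: Ue.
  rewrite (le_lt_trans (J1_metric_triangle d_J1 _ (discretize k (Z w)) _)) //.
  by rewrite (splitr e) ltrD // (lt_le_trans kh).
move=> [m _ [K _ HK]].
have m0 : 0 < m.+1%:R^-1 :> R by rewrite invr_gt0 ltr0n.
have [K' HK'] := J1_metric_discretize (Z w) m0.
apply: (HK (maxn K K')); first by rewrite /= leq_maxl.
by rewrite (J1_metric_sym d_J1) HK' // leq_maxr.
Qed.

End random_path.

End J1_measurability.

Section process_measurability.
Variables (R : realType) (d : cadlag R -> cadlag R -> R).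
Hypothesis d_J1 : J1_metric d.
Variable X : filtered_process R.

Let I1 : 0 <= (1 : R) <= 1. Proof. by rewrite ler01 lexx. Qed.

Lemma fp_filt1_preimage C : measurable C -> fp_filt X 1 (fp_proc X @^-1` C).
Proof.
pose T1 := g_sigma_algebraType (fp_filt X 1).
have sG : sigma_algebra setT (fp_filt X 1) by exact: (@fp_filt_sigma _ X).
move=> mC; suff : measurable_fun setT (fp_proc X : T1 -> cadlag R).
  by move=> /(_ measurableT C mC); rewrite setTI {1}/measurable /= sigma_algebra_id.
apply: (measurable_random_path d_J1) => t t01 _ B mB.
rewrite setTI {1}/measurable /= sigma_algebra_id //.
have /andP[t0 t1] := t01.
apply: (@fp_filt_mono _ X t 1) => //; apply: (@fp_adapted _ X t t01).
by exists B => //; rewrite setTI.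
Qed.

Lemma measurable_fp_proc : measurable_fun setT (fp_proc X).
Proof.
move=> _ C mC; rewrite setTI; apply: (@fp_filt_sub _ X 1) => //.
exact: fp_filt1_preimage.
Qed.

Lemma coordinates_measurable_fp_proc : coordinates_measurable (fp_proc X).
Proof.
move=> t t01 _ B mB; apply: (@fp_filt_sub _ X t) => //.
by apply: (@fp_adapted _ X t t01); exists B.
Qed.

End process_measurability.

(** * Joint laws of a path and a time *)

Section joint_law.
Context {R : realType}.

Lemma bounded_integrable {d} {T : measurableType d} (P : probability T R)
    (f : T -> R) M :
  measurable_fun setT f -> (forall w, `|f w| <= M) ->
  P.-integrable setT (EFin \o f).
Proof.
move=> mf fM; apply: measurable_bounded_integrable => //.
  by rewrite -ge0_fin_numE // fin_num_measure.
exists M; split=> [|N MN w _]; first exact: num_real.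
by apply: le_trans (fM w) _; exact: ltW.
Qed.

Lemma expectation_bounds {d} {T : measurableType d} (P : probability T R)
    (f : T -> R) M :
  measurable_fun setT f -> (forall w, `|f w| <= M) ->
  ((- M)%:E <= \int[P]_w (f w)%:E <= M%:E)%E.
Proof.
move=> mf fM; have If := bounded_integrable P mf fM.
have Ic c : P.-integrable setT (EFin \o cst c) by exact: finite_measure_integrable_cst.
have cE c : (\int[P]_w (cst c w)%:E = c%:E)%E.
  rewrite [LHS](integral_cst P measurableT c%:E).
  by rewrite [X in (_ * X)%E](_ : _ = 1%E) ?mule1 //; exact: probability_setT.
rewrite -(cE (- M)) -(cE M); apply/andP; split; apply: le_integral => //=;
  by [exact: Ic|move=> w _; rewrite lee_fin; have := fM w; rewrite ler_norml => /andP[]].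
Qed.

Context {d0} {E : measurableType d0}.

Section law.
Context {d1} {S1 : measurableType d1} (P1 : probability S1 R).
Context {d2} {S2 : measurableType d2} (P2 : probability S2 R).
Variables (V1 : S1 -> E) (V2 : S2 -> E) (h1 : S1 -> R) (h2 : S2 -> R).
Hypotheses (mV1 : measurable_fun setT V1) (mV2 : measurable_fun setT V2).
Hypotheses (mh1 : measurable_fun setT h1) (mh2 : measurable_fun setT h2).
Hypothesis law_rays : forall C t, measurable C ->
  P1 (V1 @^-1` C `&` [set s | h1 s < t]) = P2 (V2 @^-1` C `&` [set s | h2 s < t]).

Let law_rect C B : measurable C -> measurable B ->
  P1 (V1 @^-1` C `&` h1 @^-1` B) = P2 (V2 @^-1` C `&` h2 @^-1` B).
Proof.
move=> mC mB.
have mC1 : measurable (V1 @^-1` C) by rewrite -[X in measurable X]setTI; exact: mV1.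
have mC2 : measurable (V2 @^-1` C) by rewrite -[X in measurable X]setTI; exact: mV2.
pose m1 := pushforward (mrestr P1 mC1) h1.
pose m2 := pushforward (mrestr P2 mC2) h2.
have m1E D : m1 D = P1 (V1 @^-1` C `&` h1 @^-1` D) by exact: (congr1 P1 (setIC _ _)).
have m2E D : m2 D = P2 (V2 @^-1` C `&` h2 @^-1` D) by exact: (congr1 P2 (setIC _ _)).
suff : m1 B = m2 B by rewrite m1E m2E.
apply: (@measure_unique _ R _ (@RGenInftyO.G R) (fun k => `]-oo, k%:R[%classic)) => //.
- exact: RGenInftyO.measurableE.
- move=> _ _ [a ->] [b ->]; exists (Num.min a b).
  by apply/seteqP; split=> u /=; rewrite !in_itv /= lt_min => /andP.
- by move=> k; exists k%:R.
- apply/seteqP; split=> // u _; exists (Num.truncn u).+1 => //=.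
  by rewrite in_itv /= truncnS_gt.
- move=> _ [a ->]; transitivity (m1 `]-oo, a[%classic) => //.
  transitivity (m2 `]-oo, a[%classic) => //; rewrite m1E m2E.
  have rayE (S : Type) (h : S -> R) : h @^-1` `]-oo, a[%classic = [set s | h s < a].
    by apply/seteqP; split=> u /=; rewrite in_itv.
  by rewrite !rayE; exact: law_rays.
- move=> k; apply: (@le_lt_trans _ _ (m1 `]-oo, k%:R[%classic)) => //; rewrite m1E.
  rewrite (le_lt_trans _ (ltry 1)) //; apply: probability_le1.
  apply: measurableI => //; rewrite -[X in measurable X]setTI; exact: mh1.
Qed.

(** Rays suffice in the time variable once the event of the path is fixed, and
    rectangles suffice on the product. *)
Lemma joint_law A : measurable A ->
  P1 [set s | A (V1 s, h1 s)] = P2 [set s | A (V2 s, h2 s)].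
Proof.
move=> mA; pose m1 := pushforward P1 (fun s => (V1 s, h1 s)).
pose m2 := pushforward P2 (fun s => (V2 s, h2 s)).
have mp1 : measurable_fun setT (fun s => (V1 s, h1 s)) by exact: measurable_fun_pair.
have mp2 : measurable_fun setT (fun s => (V2 s, h2 s)) by exact: measurable_fun_pair.
suff : m1 A = m2 A by [].
apply: (@measure_unique _ R _
  [set A `*` B | A in @measurable _ E & B in @measurable _ R] (fun=> setT)) => //.
- exact: measurable_prod_measurableType.
- move=> _ _ [C mC [B mB <-]] [C' mC' [B' mB' <-]].
  by exists (C `&` C'); [exact: measurableI|exists (B `&` B'); [exact: measurableI|rewrite setXI]].
- by move=> _; exists setT => //; exists setT => //; exact: setXTT.
- by apply/seteqP; split=> // z _; exists 0%N.
- by move=> _ [C mC [B mB <-]]; exact: law_rect.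
- by move=> _; apply: (@le_lt_trans _ _ 1%E); [exact: (probability_le1 P1 measurableT)|exact: ltry].
Qed.

Lemma joint_law_integral (psi : E * R -> R) M : measurable_fun setT psi ->
  (forall z, `|psi z| <= M) ->
  (\int[P1]_s (psi (V1 s, h1 s))%:E = \int[P2]_s (psi (V2 s, h2 s))%:E)%E.
Proof.
move=> mpsi psiM.
have mp1 : measurable_fun setT (fun s => (V1 s, h1 s)) by exact: measurable_fun_pair.
have mp2 : measurable_fun setT (fun s => (V2 s, h2 s)) by exact: measurable_fun_pair.
have I1 : P1.-integrable setT (EFin \o (psi \o (fun s => (V1 s, h1 s)))).
  by apply: (@bounded_integrable _ _ _ _ M) => [|w /=//]; exact: measurableT_comp.
have I2 : P2.-integrable setT (EFin \o (psi \o (fun s => (V2 s, h2 s)))).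
  by apply: (@bounded_integrable _ _ _ _ M) => [|w /=//]; exact: measurableT_comp.
have mE : measurable_fun setT (EFin \o psi) by exact/measurable_EFinP.
have := integral_pushforward mp1 mE I1 measurableT.
have := integral_pushforward mp2 mE I2 measurableT.
rewrite !preimage_setT => /= <- <-.
by apply: eq_measure_integral => A mA _; exact: joint_law.
Qed.

End law.
End joint_law.

(** * Randomised stopping times *)

Section randomized_stopping.
Context {R : realType} (Y : filtered_process R).
(** A randomised stopping time of Y, encoded by its conditional distribution
    function given Y at rational times, and revealed with delay eps. Since the
    filtration is right-continuous, constraining Z q at the times after
    q + eps is as good as constraining it at q + eps. *)
Definition delayed_cdf (eps : R) (Z : rat -> fp_space Y -> R) : Prop :=
  [/\ forall q w, 0 <= Z q w <= 1,
      forall q r w, 0 <= q -> q <= r -> r < 1 -> Z q w <= Z r w &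
      forall q s, 0 <= q < 1 -> ratr q + eps < s <= 1 ->
        sub_measurable (fp_filt Y s) (Z q)].

Variables (eps : R) (Z : rat -> fp_space Y -> R).
Hypothesis eps0 : 0 <= eps.
Hypothesis hZ : delayed_cdf eps Z.
Hypothesis mZ : forall q, 0 <= q < 1 -> measurable_fun setT (Z q).

(** The generalised inverse of the distribution function Z _ w, with default
    value 1 for the levels u that it does not exceed before time 1. *)
Definition quantile (w : fp_space Y) (u : R) : R :=
  inf (1 |` [set ratr q | q in [set q : rat | (0 <= q < 1) /\ u < Z q w]]).

Lemma quantile_lb w u :
  lbound (1 |` [set ratr q | q in [set q : rat | (0 <= q < 1) /\ u < Z q w]]) (0 : R).
Proof. by move=> _ [->|[q [/andP[q0 _] _] <-]] //; rewrite ler0q. Qed.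

Lemma quantile01 w u : 0 <= quantile w u <= 1.
Proof.
apply/andP; split; first by apply: lb_le_inf; [exists 1; left|exact: quantile_lb].
by apply: ge_inf; [exists 0; exact: quantile_lb|left].
Qed.

Lemma quantile_lt w u t : t <= 1 ->
  quantile w u < t <-> exists2 q : rat, 0 <= q < 1 & ratr q < t /\ u < Z q w.
Proof.
move=> t1; split=> [/inf_lt[]|[q q01 [qt uZ]]].
- by exists 1; left.
- by move=> _ [->|[q [q01 uZ] <-]] ht; [rewrite ltNge t1 in ht|exists q].
- by apply: le_lt_trans qt; apply: ge_inf; [exists 0; exact: quantile_lb|right; exists q].
Qed.

Definition quantile_time (u : R) (w : fp_space Y) : R := clamp01 (quantile w u + eps).

(** For t < 1 the event is decided at any time s > t by countably many events
    {u < Z q} with q + eps < s; right-continuity of the filtration concludes. *)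
Lemma quantile_stopping_time u : stopping_time (quantile_time u).
Proof.
split=> [w|t /andP[t0]]; first exact: clamp01_itv.
have G (s : R) : 0 <= s <= 1 -> sigma_algebra setT (fp_filt Y s) by exact: fp_filt_sigma.
rewrite le_eqVlt => /predU1P[->|t1].
  have I1 : 0 <= (1 : R) <= 1 by rewrite ler01 lexx.
  have [G0 GC _] := G 1 I1.
  rewrite (_ : mkset _ = setT `\` set0); first exact: GC.
  rewrite setD0; apply/seteqP; split=> // w _ /=.
  by have /andP[] := clamp01_itv (quantile w u + eps).
apply: (@fp_filt_right _ Y t); first by rewrite t0.
move=> s /= /andP[ts s1].
have s01 : 0 <= s <= 1 by rewrite s1 (le_trans t0) // ltW.
have st0 : 0 < s - t by rewrite subr_gt0.
(* The thresholds decrease to t - eps, and {quantile < r n} is known at s. *)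
pose r n := t - eps + (s - t) / n.+1%:R.
have rs n : r n + eps <= s.
  have : (s - t) / n.+1%:R <= s - t.
    by rewrite ler_pdivrMr ?ltr0n // ler_peMr ?ler1n // ltW.
  by rewrite /r; move: ((s - t) / n.+1%:R) => x; lra.
have r1 n : r n <= 1 by rewrite (le_trans _ s1) // (le_trans _ (rs n)) // lerDl.
rewrite (_ : mkset _ = \bigcap_n [set w | quantile w u < r n]); last first.
  apply/seteqP; split=> w /=.
    move=> tt n _ /=; move: tt; rewrite /quantile_time /clamp01 ge_max t0 /=.
    rewrite ge_min [1 <= t]leNgt t1 orbF => tt.
    have : 0 < (s - t) / n.+1%:R by rewrite divr_gt0.
    by rewrite /r; move: ((s - t) / n.+1%:R) => x; lra.
  move=> H; rewrite /quantile_time /clamp01 ge_max t0 /= ge_min; apply/orP; left.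
  rewrite leNgt; apply/negP => tq.
  have d0 : 0 < quantile w u + eps - t by rewrite subr_gt0.
  pose n := Num.truncn ((s - t) / (quantile w u + eps - t)).
  have := H n Logic.I => /=; rewrite ltNge => /negP; apply.
  have : (s - t) / n.+1%:R <= quantile w u + eps - t.
    rewrite ler_pdivrMr ?ltr0n // -ler_pdivrMl // mulrC ltW //.
    exact: truncnS_gt.
  by rewrite /r; move: ((s - t) / n.+1%:R) => x; lra.
suff : measurable (\bigcap_n [set w | quantile w u < r n] :
    set (g_sigma_algebraType (fp_filt Y s))).
  by rewrite {1}/measurable /= sigma_algebra_id //; exact: G.
apply: bigcapT_measurable => n.
rewrite (_ : mkset _ = \bigcup_(q : rat) [set w | (0 <= q < 1) /\ (ratr q < r n /\ u < Z q w)]).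
  apply: countable_bigcupT_measurable => // q.
  have [[q01 qr]|nq] := pselect ((0 <= q < 1) /\ ratr q < r n); last first.
    rewrite (_ : mkset _ = set0) //; apply/seteqP; split=> // w /= [q01 [qr _]].
    by case: nq.
  rewrite (_ : mkset _ = (Z q) @^-1` `]u, +oo[%classic).
    rewrite /measurable /= sigma_algebra_id; last exact: G.
    case: hZ => _ _ HZ; apply: (HZ q s q01) => //.
    by rewrite s1 andbT (lt_le_trans _ (rs n)) // ltrD2r.
  apply/seteqP; split=> w /=; rewrite in_itv /= andbT; first by case=> _ [].
  by move=> ->.
apply/seteqP; split=> w /=.
  by move/(quantile_lt _ _ (r1 n)) => [q q01 [qr uZ]]; exists q.
by move=> [q _ [q01 [qr uZ]]]; apply/(quantile_lt _ _ (r1 n)); exists q.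
Qed.

Lemma measurable_Z_subgraph q : 0 <= q < 1 ->
  measurable [set z : fp_space Y * measurableTypeR R | z.2 < Z q z.1].
Proof. by move=> q01; apply: measurable_subgraph; exact: mZ. Qed.

Lemma quantile_lt_bigcup t : t <= 1 ->
  [set z : fp_space Y * measurableTypeR R | quantile z.1 z.2 < t] =
  \bigcup_(q : rat) [set z | [/\ 0 <= q < 1, ratr q < t & z.2 < Z q z.1]].
Proof.
move=> t1; apply/seteqP; split=> z /=.
  by move/(quantile_lt _ _ t1) => [q q01 [qr uZ]]; exists q.
by move=> [q _ [q01 qr uZ]]; apply/(quantile_lt _ _ t1); exists q.
Qed.

Lemma measurable_quantile :
  measurable_fun setT (fun z : fp_space Y * measurableTypeR R => quantile z.1 z.2).
Proof.
apply: (measurability (@RGenInftyO.G R)); first exact: RGenInftyO.measurableE.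
move=> _ [_ [t ->] <-]; rewrite setTI.
have [t1|t1] := leP t 1; last first.
  rewrite (_ : _ @^-1` _ = setT) //; apply/seteqP; split=> // z _ /=.
  by rewrite in_itv /= (le_lt_trans _ t1) //; case/andP: (quantile01 z.1 z.2).
rewrite (_ : _ @^-1` _ = [set z | quantile z.1 z.2 < t]); last first.
  by apply/seteqP; split=> z /=; rewrite in_itv.
rewrite quantile_lt_bigcup //; apply: countable_bigcupT_measurable => // q.
have [[q01 qr]|nq] := pselect ((0 <= q < 1) /\ ratr q < t); last first.
  rewrite (_ : mkset _ = set0) //; apply/seteqP; split=> // z /= [q01 qr _].
  by case: nq.
rewrite (_ : mkset _ = [set z | z.2 < Z q z.1]); first exact: measurable_Z_subgraph.
by apply/seteqP; split=> z /=; [case|].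
Qed.

End randomized_stopping.

Lemma rat_increasing_seq {R : realType} (t : R) : 0 < t -> t <= 1 ->
  exists q : nat -> rat, [/\ forall k, 0 <= q k < 1, forall k, ratr (q k) < t,
    {homo q : m n / (m <= n)%N >-> m <= n} &
    forall x, x < t -> exists k, x < ratr (q k)].
Proof.
move=> t0 t1.
have /choice[r hr] (k : nat) : exists r : rat,
    (0 <= r < 1) /\ (t - k.+1%:R^-1 < ratr r /\ ratr r < t).
  have lt : Num.max 0 (t - k.+1%:R^-1) < t.
    by rewrite gt_max t0 /= ltrBlDr ltrDl invr_gt0 ltr0n.
  have [r] := rat_in_itvoo lt; rewrite in_itv /= gt_max => /andP[/andP[r0 tr] rt].
  exists r; split=> //; apply/andP; split; first by rewrite -(ler0q R) ltW.
  by rewrite -(ltr_rat R) rmorph1 (lt_le_trans rt).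
pose fix q k : rat := if k is k'.+1 then Num.max (q k') (r k) else r 0%N.
have qS k : q k <= q k.+1 by rewrite /= le_max lexx.
have rq k : r k <= q k by case: k => [//|k] /=; rewrite le_max lexx orbT.
have qP k : (0 <= q k < 1) /\ ratr (q k) < t.
  elim: k => [|k [qk01 qkt]] /=; first by have [h1 [_ h2]] := hr 0%N.
  by have [h1 [_ h2]] := hr k.+1; case: (leP (q k) (r k.+1)).
exists q; split.
- by move=> k; case: (qP k).
- by move=> k; case: (qP k).
- by apply: homo_leq => //; exact: le_trans.
- move=> x xt; have tx0 : 0 < t - x by rewrite subr_gt0.
  exists (Num.truncn (t - x)^-1); set k := Num.truncn _.
  have kx : k.+1%:R^-1 <= t - x.
    by rewrite invf_ple ?posrE ?ltr0n // ltW // truncnS_gt.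
  have [_ [h _]] := hr k.
  rewrite (lt_le_trans _ (_ : ratr (r k) <= _)) ?ler_rat //.
  apply: le_lt_trans h; move: kx; move: (k.+1%:R^-1) => y; lra.
Qed.

Section optimal_stopping_bounds.
Context {R : realType} (d : cadlag R -> cadlag R -> R).
Hypothesis d_J1 : J1_metric d.
Variable X : filtered_process R.
Variables (phi : cadlag R * R -> R) (M : R).
Hypothesis mphi : measurable_fun setT
  (fun z : cadlag R * R => phi (z.1, clamp01 z.2)).
Hypothesis phiM : forall f t, 0 <= t <= 1 -> `|phi (f, t)| <= M.

Lemma measurable_stopping_time (tau : fp_space X -> R) :
  stopping_time tau -> measurable_fun setT tau.
Proof.
move=> [tau01 Ftau].
apply: (measurability (@RGenOInfty.G R)); first exact: RGenOInfty.measurableE.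
move=> _ [_ [t ->] <-]; rewrite setTI.
rewrite (_ : _ @^-1` _ = ~` [set w | tau w <= t]); last first.
  apply/seteqP; split=> w /=; rewrite in_itv /= andbT ltNge; [exact/negP|by move/negP].
apply: measurableC; have [t0|t0] := ltP t 0.
  rewrite (_ : mkset _ = set0) //; apply/seteqP; split=> // w /=.
  by rewrite leNgt (lt_le_trans t0) //; case/andP: (tau01 w).
have [t1|t1] := leP t 1.
  by apply: (@fp_filt_sub _ X t); [rewrite t0|apply: Ftau; rewrite t0].
rewrite (_ : mkset _ = setT) //; apply/seteqP; split=> // w _ /=.
by rewrite (le_trans _ (ltW t1)) //; case/andP: (tau01 w).
Qed.

Lemma measurable_reward (tau : fp_space X -> R) : stopping_time tau ->
  measurable_fun setT (fun w => phi (fp_proc X w, tau w)).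
Proof.
move=> tauP; have mtau := measurable_stopping_time tauP.
rewrite (_ : (fun w => _) =
    (fun z => phi (z.1, clamp01 z.2)) \o (fun w => (fp_proc X w, tau w))).
  apply: (measurableT_comp mphi); apply: measurable_fun_pair => //.
  exact: (measurable_fp_proc d_J1).
by apply/funext => w /=; rewrite clamp01_id //; case: tauP.
Qed.

Lemma OS_le (tau : fp_space X -> R) : stopping_time tau ->
  (OS X phi <= \int[fp_prob X]_w (phi (fp_proc X w, tau w))%:E)%E.
Proof.
by move=> tauP; apply: ereal_inf_lbound; exists tau => //; rewrite unlock.
Qed.

Lemma OS_fin : exists2 r, OS X phi = r%:E & `|r| <= M.
Proof.
have bd (tau : fp_space X -> R) : stopping_time tau ->
    ((- M)%:E <= \int[fp_prob X]_w (phi (fp_proc X w, tau w))%:E <= M%:E)%E.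
  move=> tauP; apply: expectation_bounds; first exact: measurable_reward.
  by move=> w; apply: phiM; case: tauP.
have st0 : stopping_time (X := X) (fun=> 0).
  split=> [_|t /andP[t0 t1]]; first by rewrite lexx ler01.
  have [G0 GC _] : sigma_algebra setT (fp_filt X t) by apply: fp_filt_sigma; rewrite t0.
  rewrite (_ : mkset _ = setT `\` set0); first exact: GC.
  by rewrite setD0; apply/seteqP; split.
have lo : ((- M)%:E <= OS X phi)%E.
  apply/ereal_infP => _ [tau tauP <-]; rewrite unlock.
  by case/andP: (bd _ tauP).
have hi : (OS X phi <= M%:E)%E.
  by apply: le_trans (OS_le st0) _; case/andP: (bd _ st0).
move: lo hi; case: (OS X phi) => [r| |] //; rewrite !lee_fin => lo hi.
by exists r => //; rewrite ler_norml lo.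
Qed.

End optimal_stopping_bounds.

Section randomized_stopping_value.
Context {R : realType} (d : cadlag R -> cadlag R -> R).
Hypothesis d_J1 : J1_metric d.
Variable Y : filtered_process R.
Local Notation P := (fp_prob Y).
Variables (eps : R) (Z : rat -> fp_space Y -> R).
Hypothesis eps0 : 0 <= eps.
Hypothesis hZ : delayed_cdf eps Z.
Hypothesis mZ : forall q, 0 <= q < 1 -> measurable_fun setT (Z q).
Context {disp} {S : measurableType disp} (P' : probability S R).
Variables (V : S -> cadlag R) (th : S -> R).
Hypotheses (mV : measurable_fun setT V) (mth : measurable_fun setT th).
Hypothesis th01 : forall s, 0 <= th s <= 1.
Hypothesis Z_law : forall q C, 0 <= q < 1 -> measurable C ->
  (\int[P]_(w in fp_proc Y @^-1` C) (Z q w)%:E =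
   P' (V @^-1` C `&` [set s | (th s <= ratr q)%R]))%E.
Hypothesis Y_law : forall C, measurable C -> P (fp_proc Y @^-1` C) = P' (V @^-1` C).

Let mu : probability (fp_space Y * measurableTypeR R)%type R := (P \x unif R)%E.

Let mY1 : measurable_fun setT (fun z : fp_space Y * measurableTypeR R => fp_proc Y z.1).
Proof. by apply: measurableT_comp => //; exact: (measurable_fp_proc d_J1). Qed.

Let mu_subgraph q C : 0 <= q < 1 ->
  mu ([set z | C (fp_proc Y z.1)] `&` [set z | z.2 < Z q z.1]) =
  (\int[P]_(w in fp_proc Y @^-1` C) (Z q w)%:E)%E.
Proof.
by move=> q01; apply: (product_unif_subgraph P (fp_proc Y @^-1` C)); case: hZ.
Qed.

(** By monotonicity in q, the region {quantile < t} is the increasing union of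
    the subgraphs {u < Z q} along any sequence of rationals q increasing to t,
    so both sides are limits of the values prescribed for Z q. *)
Lemma quantile_law C t : measurable C ->
  P' (V @^-1` C `&` [set s | th s < t]) =
  mu ((fun z => fp_proc Y z.1) @^-1` C `&` [set z | quantile Z z.1 z.2 < t]).
Proof.
move=> mC.
have mCV : measurable (V @^-1` C) by rewrite -[X in measurable X]setTI; exact: mV.
have mCY : measurable ((fun z : fp_space Y * measurableTypeR R => fp_proc Y z.1) @^-1` C).
  by rewrite -[X in measurable X]setTI; exact: mY1.
have [t0|t0] := leP t 0.
  rewrite (_ : [set s | th s < t] = set0); last first.
    apply/seteqP; split=> // s /=; rewrite ltNge (le_trans t0) //.
    by case/andP: (th01 s).
  rewrite (_ : [set z | quantile Z z.1 z.2 < t] = set0); last first.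
    apply/seteqP; split=> // z /=; rewrite ltNge (le_trans t0) //.
    by case/andP: (quantile01 Z z.1 z.2).
  by rewrite !setI0 !measure0.
have [t1|t1] := leP t 1; last first.
  rewrite (_ : [set s | th s < t] = setT); last first.
    apply/seteqP; split=> // s _ /=; rewrite (le_lt_trans _ t1) //.
    by case/andP: (th01 s).
  rewrite (_ : [set z | quantile Z z.1 z.2 < t] = setT); last first.
    apply/seteqP; split=> // z _ /=; rewrite (le_lt_trans _ t1) //.
    by case/andP: (quantile01 Z z.1 z.2).
  rewrite !setIT -Y_law //.
  rewrite (_ : (fun z : fp_space Y * measurableTypeR R => fp_proc Y z.1) @^-1` C =
    (fp_proc Y @^-1` C) `*` setT); last first.
    by apply/seteqP; split=> z /=; [|case].
  rewrite /mu /= product_measure1E //; last first.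
    by rewrite -[X in measurable X]setTI; exact: (measurable_fp_proc d_J1).
  by rewrite [X in (_ * X)%E](_ : _ = 1%E) ?mule1 //; exact: probability_setT.
have [q [q01 qt qmono qlim]] := rat_increasing_seq t0 t1.
pose F k := V @^-1` C `&` [set s | th s <= ratr (q k)].
pose G k := (fun z => fp_proc Y z.1) @^-1` C `&`
  [set z : fp_space Y * measurableTypeR R | z.2 < Z (q k) z.1].
have mF k : measurable (F k).
  apply: measurableI => //; rewrite -[X in measurable X]setTI.
  exact: measurable_fun_ler.
have mG k : measurable (G k).
  by apply: measurableI => //; exact: measurable_subgraph (mZ (q01 k)).
have FE : V @^-1` C `&` [set s | th s < t] = \bigcup_k F k.
  apply/seteqP; split=> s /=.
    by move=> [Cs st]; have [k sk] := qlim _ st; exists k => //; split=> //=; exact: ltW.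
  by move=> [k _ [Cs sk]]; split=> //; exact: le_lt_trans (qt k).
have GE : (fun z => fp_proc Y z.1) @^-1` C `&` [set z | quantile Z z.1 z.2 < t]
    = \bigcup_k G k.
  apply/seteqP; split=> z /=.
    move=> [Cz /(quantile_lt _ _ _ t1)[r r01 [rt uZ]]].
    have [k rk] := qlim _ rt; exists k => //; split=> //=; apply: (lt_le_trans uZ).
    case: hZ => _ Zmono _; apply: Zmono.
    - by case/andP: r01.
    - by rewrite -(ler_rat R) ltW.
    - by case/andP: (q01 k).
  move=> [k _ [Cz uZ]]; split=> //; apply/(quantile_lt _ _ _ t1).
  by exists (q k).
have FG k : P' (F k) = mu (G k) by rewrite mu_subgraph // Z_law.
have cF : (P' \o F) k @[k --> \oo] --> P' (\bigcup_k F k).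
  apply: nondecreasing_cvg_mu => //; first exact: bigcupT_measurable.
  move=> m n mn; apply/subsetPset => s [Cs sm]; split=> //=.
  by rewrite (le_trans sm) // ler_rat qmono.
have cG : (mu \o G) k @[k --> \oo] --> mu (\bigcup_k G k).
  apply: nondecreasing_cvg_mu => //; first exact: bigcupT_measurable.
  move=> m n mn; apply/subsetPset => z [Cz zm]; split=> //=.
  apply: (lt_le_trans zm); case: hZ => _ Zmono _; apply: Zmono.
  - by case/andP: (q01 m).
  - exact: qmono.
  - by case/andP: (q01 n).
rewrite FE GE; move: cF; rewrite (_ : P' \o F = mu \o G); last first.
  by apply/funext => k; exact: FG.
by move=> cF; exact: (cvg_unique _ cF cG).
Qed.

Variables (phi : cadlag R * R -> R) (M : R).
Hypothesis mphi : measurable_fun setT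
  (fun z : cadlag R * R => phi (z.1, clamp01 z.2)).
Hypothesis phiM : forall f t, 0 <= t <= 1 -> `|phi (f, t)| <= M.

(** The pairs (V, th) and (Y, quantile) have the same law. Freezing the level u
    turns the delayed quantile into a stopping time of Y, whose expected reward
    is at least the value. *)
Lemma OS_le_randomized :
  (OS Y phi <= \int[P']_s (phi (V s, clamp01 (th s + eps)))%:E)%E.
Proof.
pose psi (z : cadlag R * R) := phi (z.1, clamp01 (z.2 + eps)).
have mpsi : measurable_fun setT psi.
  rewrite (_ : psi = (fun z => phi (z.1, clamp01 z.2)) \o
    (fun z : cadlag R * R => (z.1, z.2 + eps))) //.
  apply: (measurableT_comp mphi); apply: measurable_fun_pair => //=; exact: measurable_funD.
have psiM z : `|psi z| <= M by apply: phiM; exact: clamp01_itv.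
rewrite (_ : (\int[P']_s _)%E = \int[P']_s (psi (V s, th s))%:E)%E //.
have mq := measurable_quantile mZ.
rewrite (@joint_law_integral _ _ _ _ _ P' _ _ mu V (fun z => fp_proc Y z.1)
  th (fun z => quantile Z z.1 z.2) _ _ _ _ _ psi M) //; last exact: quantile_law.
pose F (z : fp_space Y * measurableTypeR R) := (psi (fp_proc Y z.1, quantile Z z.1 z.2))%:E.
have IF : mu.-integrable setT F.
  apply: (@bounded_integrable _ _ _ mu
    (fun z => psi (fp_proc Y z.1, quantile Z z.1 z.2)) M) => [|z]; last exact: psiM.
  by apply: (measurableT_comp mpsi); exact: measurable_fun_pair.
rewrite -[X in (_ <= X)%E](@integral21_prod_meas1 _ _ _ _ R P (unif R) F IF).
have mG := @measurable_fubini_G _ _ _ _ R P (unif R) F IF.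
have [r OSr _] := OS_fin d_J1 Y mphi phiM.
have -> : OS Y phi = (\int[unif R]_u (EFin \o cst r) u)%E.
  rewrite [RHS](integral_cst (unif R) measurableT r%:E).
  by rewrite [X in (_ * X)%E](_ : _ = 1%E) ?mule1 //; exact: probability_setT.
apply: le_integral => //.
- exact: finite_measure_integrable_cst.
- apply/integrableP; split; first exact: mG.
  apply: (@le_lt_trans _ _ (M%:E * unif R setT)%E).
    apply: integral_le_bound => //.
      by rewrite lee_fin (le_trans _ (psiM (cadlag0 R, 0))).
    apply: aeW => u _; rewrite /fubini_G /F.
    have := @expectation_bounds _ _ _ P (fun w => psi (fp_proc Y w, quantile Z w u)) M.
    move=> /(_ _ _)/wrap[].
    - apply: (measurableT_comp mpsi); apply: measurable_fun_pair.
        exact: (measurable_fp_proc d_J1).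
      exact: (measurableT_comp mq (measurable_pair2 u)).
    - by move=> w; exact: psiM.
    rewrite /=; case: (integral _ _ _) => [x| |]; by
      [rewrite !lee_fin ler_norml|move=> /andP[]].
  by rewrite [X in (_ * X)%E](_ : _ = 1%E) ?mule1 ?ltry //; exact: probability_setT.
move=> u _; rewrite /= -OSr; apply: le_trans (OS_le phi (quantile_stopping_time eps0 hZ u)) _.
by rewrite /fubini_G /F /psi.
Qed.
End randomized_stopping_value.

(** * Stopping times seen through a causal coupling *)

Section running_supremum.
Context {R : realType} {T : Type} (rho : rat -> T -> R).
Hypothesis rho01 : forall r w, 0 <= rho r w <= 1.

(** Makes a family that is monotone almost surely monotone everywhere, while the
    value at q only involves earlier times. *)
Definition running_sup (q : rat) (w : T) : R :=
  sup [set rho r w | r in [set r | 0 <= r <= q]].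

Lemma running_sup_has_ubound q w :
  has_ubound [set rho r w | r in [set r | 0 <= r <= q]].
Proof. by exists 1 => _ [r _ <-]; case/andP: (rho01 r w). Qed.

Lemma running_sup_ge q r w : 0 <= r -> r <= q -> rho r w <= running_sup q w.
Proof.
move=> r0 rq; apply: ub_le_sup; first exact: running_sup_has_ubound.
by exists r => //=; rewrite r0.
Qed.

Lemma running_sup_le q w c : 0 <= q -> (forall r, 0 <= r <= q -> rho r w <= c) ->
  running_sup q w <= c.
Proof.
move=> q0 H; apply: ge_sup; last by move=> _ [r rq <-]; exact: H.
by exists (rho 0 w), 0 => //=; rewrite lexx.
Qed.

Lemma running_sup01 q w : 0 <= running_sup q w <= 1.
Proof.
have [q0|q0] := leP 0 q; last first.
  rewrite /running_sup (_ : mkset _ = set0).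
    by rewrite image_set0 sup0 lexx ler01.
  apply/seteqP; split=> // r /= /andP[r0 rq].
  by have := le_trans r0 rq; rewrite leNgt q0.
apply/andP; split.
  by apply: le_trans (running_sup_ge w (lexx 0) q0); case/andP: (rho01 0 w).
by apply: running_sup_le => // r _; case/andP: (rho01 r w).
Qed.

Lemma running_sup_mono q r w : 0 <= q -> q <= r -> running_sup q w <= running_sup r w.
Proof.
move=> q0 qr; apply: running_sup_le => // p /andP[p0 pq].
by apply: running_sup_ge => //; exact: le_trans qr.
Qed.

Lemma running_sup_gt q w c : 0 <= q ->
  c < running_sup q w <-> exists2 r, 0 <= r <= q & c < rho r w.
Proof.
move=> q0; split=> [/sup_gt[]|[r /andP[r0 rq] cr]].
- by exists (rho 0 w), 0 => //=; rewrite lexx.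
- by move=> _ [r rq <-] cr; exists r.
- by rewrite (lt_le_trans cr) // running_sup_ge.
Qed.

End running_supremum.

Lemma ae_forall_rat {R : realType} {d} {T : measurableType d} (P : probability T R)
    (A : rat -> T -> Prop) :
  (forall q, {ae P, forall w, A q w}) -> {ae P, forall w, forall q, A q w}.
Proof.
move=> H; have : {ae P, forall w, forall n, forall q, @unpickle rat n = Some q -> A q w}.
  apply: ae_foralln => n; case: (unpickle n) => [r|]; last by apply: aeW.
  by apply: filterS (H r) => w Aw q [<-].
by apply: filterS => w Aw q; apply: (Aw (pickle q)); rewrite pickleK.
Qed.

Section causal_delayed_cdf.
Context {R : realType} (X Y : filtered_process R).
Context {d} {T : measurableType d} (pi : probability T R).
Variables (x : T -> fp_space X) (y : T -> fp_space Y) (s : fp_space Y -> T).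
Hypothesis mx : measurable_fun setT x.
Hypothesis my : measurable_fun setT y.
Hypothesis ys : forall v, y (s v) = v.
Hypothesis piy : forall B, measurable B -> pushforward pi y B = fp_prob Y B.
Variable eps : R.
Hypothesis eps0 : 0 <= eps.
Hypothesis ci : causal pi y x eps.
Variable tau : fp_space X -> R.
Hypothesis tauP : stopping_time tau.

(** The conditional probabilities of {tau <= q} given Y that causality provides
    increase with q only almost surely; taking running suprema changes each of
    them on a null set. *)
Lemma causal_delayed_cdf : exists Z : rat -> fp_space Y -> R,
  [/\ delayed_cdf eps Z,
      forall q, 0 <= q < 1 -> measurable_fun setT (Z q) &
      forall q B, 0 <= q < 1 -> fp_filt Y 1 B ->
        (\int[fp_prob Y]_(v in B) (Z q v)%:E =
         pi (x @^-1` [set w | (tau w <= ratr q)%R] `&` y @^-1` B))%E].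
Proof.
have I1 : 0 <= (1 : R) <= 1 by rewrite ler01 lexx.
pose A (q : rat) := [set w : fp_space X | tau w <= ratr q].
have ratr01 (q : rat) : 0 <= q < 1 -> 0 <= (ratr q : R) <= 1.
  by move=> /andP[q0 q1]; rewrite ler0q q0 -[1](rmorph1 (@ratr R)) ler_rat ltW.
have /choice[rho hrho] (q : rat) : exists rho : fp_space Y -> R,
    (forall v, 0 <= rho v <= 1) /\ (0 <= q < 1 ->
    sub_measurable (fp_filt Y (Num.min (ratr q + eps) 1)) rho /\
    forall B, fp_filt Y 1 B -> (\int[fp_prob Y]_(v in B) (rho v)%:E =
           pi (x @^-1` A q `&` y @^-1` B))%E).
  have [q01|_] := boolP (0 <= q < 1); last first.
    by exists (fun=> 0); split=> // _; rewrite lexx ler01.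
  have t01 := ratr01 _ q01; have FA : fp_filt X (ratr q) (A q) by case: tauP => _; exact.
  have [rho [h1 h2 h3]] := causal_density mx my ys piy eps0 t01 ci FA.
  by exists rho.
have rho01 q v : 0 <= rho q v <= 1 by case: (hrho q).
pose Z := running_sup rho.
have min01 (q : rat) : 0 <= q < 1 -> 0 <= Num.min (ratr q + eps) 1 <= 1.
  move=> /ratr01/andP[q0 q1].
  by rewrite ge_min lexx orbT le_min ler01 addr_ge0.
have ZF q t : 0 <= q < 1 -> Num.min (ratr q + eps) 1 <= t <= 1 ->
    sub_measurable (fp_filt Y t) (Z q).
  move=> q01 /andP[qt t1]; have /andP[q0 q1] := q01.
  have t01 : 0 <= t <= 1.
    by rewrite t1 (le_trans _ qt) //; case/andP: (min01 _ q01).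
  have sG := @fp_filt_sigma _ Y t t01.
  apply: sub_measurable_gt => // c.
  suff : measurable ([set w | c < Z q w] : set (g_sigma_algebraType (fp_filt Y t))).
    by rewrite {1}/measurable /= sigma_algebra_id.
  rewrite (_ : mkset _ = \bigcup_(r : rat) [set w | 0 <= r <= q /\ c < rho r w]); last first.
    apply/seteqP; split=> w /=; first by move/(running_sup_gt rho01 _ _ q0) => [r rq cr]; exists r.
    by move=> [r _ [rq cr]]; apply/(running_sup_gt rho01 _ _ q0); exists r.
  apply: countable_bigcupT_measurable => // r.
  have [/andP[r0 rq]|nrq] := boolP (0 <= r <= q); last first.
    by rewrite (_ : mkset _ = set0) //; apply/seteqP; split=> // w [].
  rewrite (_ : mkset _ = rho r @^-1` `]c, +oo[%classic); last first.
    by apply/seteqP; split=> w /=; rewrite in_itv /= andbT; [case|].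
  rewrite /measurable /= sigma_algebra_id //.
  have r01 : 0 <= r < 1 by rewrite r0 (le_lt_trans rq).
  have [_ /(_ r01)[Fr _]] := hrho r.
  have mr : Num.min (ratr r + eps) 1 <= t.
    rewrite (le_trans _ qt) // le_min !ge_min lexx orbT andbT lerD2r ler_rat.
    by rewrite rq.
  apply: (@fp_filt_mono _ Y _ t _ mr t1); last exact: Fr.
  by case/andP: (min01 _ r01).
have F1 q : 0 <= q < 1 -> sub_measurable (fp_filt Y 1) (rho q).
  move=> q01 B mB; have [_ /(_ q01)[Fr _]] := hrho q.
  have /andP[m0 m1] := min01 _ q01.
  exact: (@fp_filt_mono _ Y _ 1 m0 m1 (lexx 1) _ (Fr _ mB)).
have m1 f : sub_measurable (fp_filt Y 1) f -> measurable_fun setT f.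
  by apply: sub_measurable_measurable; exact: (@fp_filt_sub _ Y 1).
have ZF1 q : 0 <= q < 1 -> sub_measurable (fp_filt Y 1) (Z q).
  by move=> q01; apply: ZF => //; rewrite ge_min lexx orbT.
have rhoZ q : 0 <= q < 1 -> {ae fp_prob Y, forall v, Z q v = rho q v}.
  move=> q01; have /andP[q0 q1] := q01.
  have : {ae fp_prob Y, forall v, forall r : rat, 0 <= r <= q -> rho r v <= rho q v}.
    apply: ae_forall_rat => r; have [/andP[r0 rq]|nrq] := boolP (0 <= r <= q); last first.
      exact: aeW.
    have r01 : 0 <= r < 1 by rewrite r0 (le_lt_trans rq).
    suff : {ae fp_prob Y, forall v, rho r v <= rho q v} by apply: filterS => v + _.
    have bd p v : `|rho p v| <= 1.
      by case/andP: (rho01 p v) => h0 h1; rewrite ger0_norm.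
    apply: (@ae_le_of_le_integral _ _ _ _ (fp_filt Y 1)).
    - exact: fp_filt_sigma.
    - exact: (@fp_filt_sub _ Y 1).
    - exact: F1.
    - exact: F1.
    - by apply: (bounded_integrable _ _ (bd r)); exact: m1 (F1 _ r01).
    - by apply: (bounded_integrable _ _ (bd q)); exact: m1 (F1 _ q01).
    - move=> C FC.
      have [_ /(_ r01)[_ ->]] // := hrho r; have [_ /(_ q01)[_ ->]] // := hrho q.
      have mC : measurable C by exact: (@fp_filt_sub _ Y 1).
      have mA p : 0 <= p < 1 -> measurable (x @^-1` A p `&` y @^-1` C).
        move=> p01; apply: measurableI; rewrite -[X in measurable X]setTI.
          apply: mx => //; apply: (@fp_filt_sub _ X (ratr p)); first exact: ratr01.
          by case: tauP => _; apply; exact: ratr01.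
        exact: my.
      apply: le_measure; rewrite ?inE; [exact: mA|exact: mA|].
      move=> w [Aw Cw]; split=> //=; apply: le_trans Aw _.
      by rewrite ler_rat.
  apply: filterS => v H; apply/le_anti; rewrite running_sup_ge //.
  by rewrite running_sup_le // => r; exact: H.
exists Z; split.
- split; first by move=> q w; exact: running_sup01.
    by move=> q r w q0 qr _; exact: running_sup_mono.
  move=> q t q01 /andP[qt t1]; apply: ZF => //.
  by rewrite t1 ge_min ltW.
- by move=> q q01; exact: m1 (ZF1 _ q01).
- move=> q B q01 FB; have [_ /(_ q01)[_ /(_ _ FB) <-]] := hrho q.
  apply: ae_eq_integral => //.
  + exact: (@fp_filt_sub _ Y 1).
  + by apply/measurable_EFinP; apply: measurable_funTS; exact: m1 (ZF1 _ q01).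
  + by apply/measurable_EFinP; apply: measurable_funTS; exact: m1 (F1 _ q01).
  + by apply: filterS (rhoZ q q01) => v ->.
Qed.

End causal_delayed_cdf.

(** * Almost sure limits by minimal norm *)

Lemma cvg_of_geometric_increments {R : realType} (u : nat -> R) (c : R) :
  (forall k, `|u k - u k.+1| <= c * 2^-1 ^+ k) -> cvgn u.
Proof.
move=> uc; have -> : u = (cst (u 0%N)) \+ series (telescope u).
  by apply/funext => n; rewrite (eq_sum_telescope u).
apply: is_cvgD; first exact: is_cvg_cst.
apply: normed_cvg.
apply: (@series_le_cvg _ _ (geometric c 2^-1)).
- by move=> n; exact: normr_ge0.
- move=> n; exact: le_trans (uc n).
- by move=> n; rewrite /telescope /= distrC; exact: uc.
- by apply: is_cvg_geometric_series; rewrite ger0_norm // invf_lt1 // ltr1n.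
Qed.

Section convex_combinations.
Context {R : realType} {d} {T : measurableType d} (P : probability T R).

(** The series of 4 ^ k (f_k - f_(k+1)) ^ 2 has a finite integral, so it is
    finite almost everywhere, and the increments decay like 2 ^ (- k). *)
Lemma ae_cvg_of_fast_L2 (f : nat -> T -> R) (C : R) :
  (forall k, measurable_fun setT (f k)) ->
  (forall k, (\int[P]_w ((f k w - f k.+1 w) ^+ 2)%:E <= (C * 8^-1 ^+ k)%:E)%E) ->
  {ae P, forall w, cvgn (fun k => f k w)}.
Proof.
move=> mf fC.
have C0 : 0 <= C.
  have := fC 0%N; rewrite expr0 mulr1 => /(le_trans _); rewrite -lee_fin; apply.
  by apply: integral_ge0 => w _; rewrite lee_fin sqr_ge0.
pose h k w := (4 ^+ k * (f k w - f k.+1 w) ^+ 2)%:E : \bar R.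
have h0 k w : (0 <= h k w)%E by rewrite lee_fin mulr_ge0 ?sqr_ge0.
have mdf k : measurable_fun setT (fun w => (f k w - f k.+1 w) ^+ 2).
  by apply: measurable_funX; exact: measurable_funB.
have mh k : measurable_fun setT (h k).
  by apply/measurable_EFinP; exact: measurable_funM.
pose H w := (\sum_(0 <= k <oo) h k w)%E.
have H0 w : (0 <= H w)%E by exact: nneseries_ge0.
have IH : P.-integrable setT H.
  apply/integrableP; split; first exact: ge0_emeasurable_sum.
  under eq_integral do rewrite gee0_abs //.
  rewrite integral_nneseries //.
  apply: (@le_lt_trans _ _ (\sum_(0 <= k <oo) (0 + (2 * C / (2 ^ k.+1)%:R)%:E))%E).
    apply: lee_nneseries => [k _ _|k _]; first exact: integral_ge0.
    rewrite add0e /h; under eq_integral do rewrite EFinM.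
    rewrite ge0_integralZl//.
    - apply: (@le_trans _ _ ((4 ^+ k)%:E * (C * 8^-1 ^+ k)%:E)%E).
        by apply: lee_wpmul2l => //; rewrite lee_fin exprn_ge0.
      rewrite -EFinM lee_fin le_eqVlt; apply/orP; left; apply/eqP.
      have -> : (2 ^ k.+1)%:R = 2 * 2 ^+ k :> R by rewrite natrX exprS.
      have -> : (8 : R) = 4 * 2 by rewrite -natrM.
      rewrite exprVn exprMn; field.
      by rewrite !expf_neq0 // pnatr_eq0.
    - exact/measurable_EFinP.
    - by move=> w _; rewrite lee_fin sqr_ge0.
  apply: (le_lt_trans (@epsilon_trick R (fun=> 0%E) (2 * C) xpredT _ _)) => //.
    by rewrite mulr_ge0.
  by rewrite eseries0 // add0e ltry.
apply: filterS (integrable_ae measurableT IH) => w /(_ Logic.I) Hfin.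
have hH k : 4 ^+ k * (f k w - f k.+1 w) ^+ 2 <= fine (H w).
  rewrite -lee_fin fineK //.
  apply: le_trans (nneseries_lim_ge k.+1 (fun n _ _ => h0 n w)).
  by rewrite big_nat_recr //= leeDr // sume_ge0.
apply: (@cvg_of_geometric_increments _ _ (Num.sqrt (fine (H w)))) => k.
rewrite -(@ler_pXn2r _ 2) ?nnegrE ?mulr_ge0 ?sqrtr_ge0 ?exprn_ge0 //.
rewrite exprMn sqr_sqrtr; last by rewrite fine_ge0.
rewrite real_normK ?num_real // -exprM mulnC exprM exprVn -ler_pdivrMr; last first.
  by rewrite exprn_gt0 // exprn_gt0 // invr_gt0.
rewrite -!exprVn -exprM !invrK.
rewrite mulrC (_ : (2 : R) ^+ (2 * k) = 4 ^+ k) //.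
by rewrite exprM -natrX.
Qed.

Section minimal_norm.
Variables (I : Type) (e : nat -> I) (K : nat -> set (I -> T -> R)).
Hypothesis K_neq0 : forall n, K n !=set0.
Hypothesis K_decr : forall m n, (m <= n)%N -> K n `<=` K m.
Hypothesis K_mid : forall n a b, K n a -> K n b ->
  K n (fun i w => (a i w + b i w) / 2).
Hypothesis K_meas : forall n z i, K n z -> measurable_fun setT (z (e i)).
Hypothesis K01 : forall n z i w, K n z -> 0 <= z (e i) w <= 1.

Let sq i (z : I -> T -> R) : R := \int[P]_w (z (e i) w ^+ 2).
Let dist i (a b : I -> T -> R) : R := \int[P]_w ((a (e i) w - b (e i) w) ^+ 2).
(** Truncated at k terms, this weighted sum is finite and increases with k, while
    the sets K k decrease; so its infima over them increase. *)
Let energy k z : R := \sum_(i < k) 2^-1 ^+ i * sq i z.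

Let int_sq n z i : K n z -> P.-integrable setT (EFin \o (fun w => z (e i) w ^+ 2)).
Proof.
move=> Kz; apply: (@bounded_integrable _ _ _ _ _ 1).
  by apply: measurable_funX; exact: K_meas Kz.
move=> w; case/andP: (K01 i w Kz) => z0 z1.
by rewrite ger0_norm ?sqr_ge0 // expr_le1.
Qed.

Let int_dist n a b i : K n a -> K n b ->
  P.-integrable setT (EFin \o (fun w => (a (e i) w - b (e i) w) ^+ 2)).
Proof.
move=> Ka Kb; apply: (@bounded_integrable _ _ _ _ _ 1).
  by apply: measurable_funX; apply: measurable_funB; [exact: K_meas Ka|exact: K_meas Kb].
move=> w; case/andP: (K01 i w Ka) => a0 a1; case/andP: (K01 i w Kb) => b0 b1.
rewrite ger0_norm ?sqr_ge0 // -real_normK ?num_real // expr_le1 //.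
by rewrite ler_norml; apply/andP; split; lra.
Qed.

Let sq_ge0 i z : 0 <= sq i z.
Proof. by apply: Rintegral_ge0 => w _; exact: sqr_ge0. Qed.

Let dist_ge0 i a b : 0 <= dist i a b.
Proof. by apply: Rintegral_ge0 => w _; exact: sqr_ge0. Qed.

Let sq_le1 n i z : K n z -> sq i z <= 1.
Proof.
move=> Kz; have -> : 1 = \int[P]_w (cst 1 w) :> R.
  rewrite Rintegral_cst // mul1r -[LHS]/(fine 1%E); congr fine.
  exact/esym/probability_setT.
apply: le_Rintegral => //; first exact: int_sq Kz.
  exact: finite_measure_integrable_cst.
by move=> w _ /=; case/andP: (K01 i w Kz) => z0 z1; rewrite expr_le1.
Qed.

Let parallelogram n i a b : K n a -> K n b ->
  4 * sq i (fun i w => (a i w + b i w) / 2) + dist i a b = 2 * (sq i a + sq i b).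
Proof.
move=> Ka Kb; have Im := int_sq i (K_mid Ka Kb).
have I4 : P.-integrable setT (EFin \o (fun w => 4 * ((a (e i) w + b (e i) w) / 2) ^+ 2)).
  by apply: eq_integrable (integrableZl measurableT 4 Im) => // w _; rewrite /= EFinM.
have Iab : P.-integrable setT (EFin \o (fun w => a (e i) w ^+ 2 + b (e i) w ^+ 2)).
  by apply: eq_integrable (integrableD measurableT (int_sq i Ka) (int_sq i Kb)) => // w _;
    rewrite /= EFinD.
rewrite /sq /dist -RintegralZl // -RintegralD //; last exact: int_dist Ka Kb.
rewrite -RintegralD //; [|exact: int_sq Ka|exact: int_sq Kb].
rewrite -RintegralZl //.
by apply: eq_Rintegral => w _; field.
Qed.

Let energy_mono k l z : (k <= l)%N -> energy k z <= energy l z.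
Proof.
move=> kl; rewrite /energy -(subnKC kl) big_split_ord /= lerDl sumr_ge0 // => i _.
by rewrite mulr_ge0 // exprn_ge0.
Qed.

Let energy_ge0 k z : 0 <= energy k z.
Proof. by apply: sumr_ge0 => i _; rewrite mulr_ge0 // exprn_ge0. Qed.

Let energy_le2 n k z : K n z -> energy k z <= 2.
Proof.
move=> Kz; apply: (@le_trans _ _ (\sum_(i < k) 2^-1 ^+ i)).
  apply: ler_sum => i _; rewrite ler_piMr ?exprn_ge0 //; exact: sq_le1 Kz.
suff -> : \sum_(i < k) 2^-1 ^+ i = 2 - 2 * 2^-1 ^+ k :> R.
  by rewrite lerBlDr lerDl mulr_ge0 // exprn_ge0.
elim: k => [|k IH]; first by rewrite big_ord0 expr0 mulr1 subrr.
by rewrite big_ord_recr /= IH exprS; field.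
Qed.

Let inf_energy n := inf [set energy n z | z in K n].

Let inf_energy_le n z : K n z -> inf_energy n <= energy n z.
Proof. by move=> Kz; apply: ge_inf; [exists 0 => _ [y _ <-]|exists z]. Qed.

Let inf_energy_mono m n : (m <= n)%N -> inf_energy m <= inf_energy n.
Proof.
move=> mn; apply: lb_le_inf.
  by have [z Kz] := K_neq0 n; exists (energy n z), z.
move=> _ [z Kz <-]; apply: le_trans (energy_mono z mn).
by apply: inf_energy_le; exact: K_decr Kz.
Qed.

(** The argument behind Mazur's lemma. The midpoint of two near-minimisers of the
    energy over K n stays in K n, so by the parallelogram identity they are
    close to each other. The indices e i are handled by one energy, because the
    members of K n tie them together: separate sequences for separate indices
    would lose these constraints. *)
Lemma exists_ae_cvg_sequence : exists z : nat -> I -> T -> R,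
  (forall k, K k (z k)) /\
  forall i, {ae P, forall w, cvgn (fun k => z k (e i) w)}.
Proof.
have hs : has_sup (range inf_energy).
  split; first by exists (inf_energy 0), 0%N.
  exists 2 => _ [n _ <-]; have [z Kz] := K_neq0 n.
  exact: le_trans (inf_energy_le Kz) (energy_le2 n Kz).
pose a := sup (range inf_energy).
have a_ge n : inf_energy n <= a by apply: ub_le_sup; [case: hs|exists n].
pose delta k : R := 8^-1 ^+ k.
have delta0 k : 0 < delta k by rewrite exprn_gt0 // invr_gt0.
have /choice[M hM] k : exists n, a - delta k < inf_energy n.
  by have [_ [n _ <-] h] := sup_adherent (delta0 k) hs; exists n.
(* N k is at least k, so that the energy sees the first k indices, and at least
   M k, so that the infimum is delta k-close to its limit a. *)
pose N k := (k + \sum_(i < k.+1) M i)%N.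
have N_mono k : (N k <= N k.+1)%N.
  by rewrite /N leq_add // [in leqRHS]big_ord_recr /= leq_addr.
have N_ge k : (k <= N k)%N by exact: leq_addr.
have hN k : a - delta k < inf_energy (N k).
  apply: lt_le_trans (hM k) (inf_energy_mono _).
  by rewrite /N big_ord_recr /= addnA leq_addl.
have /choice[z hz] k : exists z, K (N k) z /\ energy (N k) z < a + delta k.
  have hi : has_inf [set energy (N k) z | z in K (N k)].
    split; first by have [z Kz] := K_neq0 (N k); exists (energy (N k) z), z.
    by exists 0 => _ [z _ <-].
  have [_ [z Kz <-] zlt] := inf_adherent (delta0 k) hi.
  by exists z; split=> //; rewrite (lt_le_trans zlt) // lerD2r; exact: a_ge.
have zK k : K k (z k) by apply: (K_decr (N_ge k)); case: (hz k).
exists z; split=> // i.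
have dist_z k : (i < k)%N -> dist i (z k) (z k.+1) <= 2 ^+ i * 8 * delta k.
  move=> ik; have [Kk Ek] := hz k; have [Kk1' Ek1] := hz k.+1.
  have Kk1 : K (N k) (z k.+1) by exact: K_decr (N_mono k) _ Kk1'.
  have Em := inf_energy_le (K_mid Kk Kk1).
  have Ek1' : energy (N k) (z k.+1) < a + delta k.
    apply: le_lt_trans (energy_mono _ (N_mono k)) (lt_le_trans Ek1 _).
    by rewrite lerD2l /delta exprS ler_piMl // ?exprn_ge0 // invf_le1 // ler1n.
  have sumE : 4 * energy (N k) (fun i w => (z k i w + z k.+1 i w) / 2) +
      \sum_(j < N k) 2^-1 ^+ j * dist j (z k) (z k.+1) =
      2 * (energy (N k) (z k) + energy (N k) (z k.+1)).
    rewrite /energy -big_split /= !mulr_sumr -big_split /=.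
    apply: eq_bigr => j _; have := parallelogram j Kk Kk1.
    set s1 := sq _ _; set s2 := dist _ _ _; set s3 := sq _ _; set s4 := sq _ _.
    rewrite mulrCA -mulrDr => ->; ring.
  have iN : (i < N k)%N by exact: leq_trans ik (N_ge k).
  have : 2^-1 ^+ i * dist i (z k) (z k.+1) <=
      \sum_(j < N k) 2^-1 ^+ j * dist j (z k) (z k.+1).
    rewrite (bigD1 (Ordinal iN)) //= lerDl sumr_ge0 // => j _.
    by rewrite mulr_ge0 // exprn_ge0.
  move=> le_i; have := hN k; move: (delta k) Em Ek Ek1' sumE => dk Em Ek Ek1' sumE hNk.
  rewrite -mulrA -ler_pdivrMl ?exprn_gt0 // -exprVn.
  by apply: le_trans le_i _; lra.
have := @ae_cvg_of_fast_L2 (fun k => z (k + i.+1)%N (e i)) (2 ^+ i * 8).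
move=> /(_ _ _)/wrap[].
- by move=> k; exact: K_meas (zK _).
- move=> k; have ik : (i < k + i.+1)%N by rewrite ltn_addl.
  have := dist_z _ ik; rewrite -lee_fin /dist /Rintegral fineK; last first.
    by apply: integrable_fin_num => //; apply: int_dist (zK _) _; exact: (K_decr (leqnSn _) (zK _)).
  move=> /le_trans; apply; rewrite lee_fin ler_wpM2l ?mulr_ge0 ?exprn_ge0 //.
  rewrite /delta exprD ler_piMr ?exprn_ge0 // exprn_ile1 // ?invr_ge0 // invf_le1 //.
  by rewrite ler1n.
by apply: filterS => w /(cvgP _) cz; apply/cvg_ex; move/cvg_ex: cz => [l hl];
  exists l; rewrite -(cvg_shiftn i.+1).
Qed.

End minimal_norm.

End convex_combinations.

(** * Processes that are close in the adapted distance *)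

Section close_processes.
Variables (R : realType) (d : cadlag R -> cadlag R -> R).
Hypothesis d_J1 : J1_metric d.

(** A coupling with small delay under which the paths are close in probability.
    It lives on an arbitrary space, which makes the roles of X and Y symmetric.
    The sections express that x and y are onto. *)
Definition close (delta : R) (X Y : filtered_process R) : Prop :=
  exists disp (T : measurableType disp) (pi : probability T R)
    (x : T -> fp_space X) (y : T -> fp_space Y) (eps : R),
  [/\ [/\ measurable_fun setT x, measurable_fun setT y,
          forall A, measurable A -> pushforward pi x A = fp_prob X A &
          forall B, measurable B -> pushforward pi y B = fp_prob Y B],
      (exists s, cancel s x) /\ (exists s, cancel s y),
      0 <= eps < delta,
      causal pi x y eps /\ causal pi y x eps &
      (pi [set w | delta <= d (fp_proc X (x w)) (fp_proc Y (y w))]%R <= delta%:E)%E].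

Lemma close_sym delta X Y : close delta X Y -> close delta Y X.
Proof.
move=> [disp [T [pi [x [y [eps [[mx my pix piy] [sx sy] e01 [cxy cyx] h]]]]]]].
exists disp, T, pi, y, x, eps; split => //.
by under eq_set do rewrite (J1_metric_sym d_J1).
Qed.

Lemma measurable_proc_dist X Y disp (T : measurableType disp)
    (x : T -> fp_space X) (y : T -> fp_space Y) :
  measurable_fun setT x -> measurable_fun setT y ->
  measurable_fun setT (fun w => d (fp_proc X (x w)) (fp_proc Y (y w))).
Proof.
move=> mx my; apply: (measurable_J1_metric d_J1
    (Z := fun w => fp_proc X (x w)) (Z' := fun w => fp_proc Y (y w))).
  by move=> t t01; exact: (measurableT_comp (coordinates_measurable_fp_proc t01) mx).
by move=> t t01; exact: (measurableT_comp (coordinates_measurable_fp_proc t01) my).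
Qed.

(** By Markov's inequality: when the p-th root of the p-th moment of the distance
    is below delta ^ 2, the distance exceeds delta with probability at most
    delta ^ p <= delta. *)
Lemma AW_close p X Y delta : 1 <= p -> 0 < delta <= 1 ->
  (AW d p X Y < (delta ^+ 2)%:E)%E -> close delta X Y.
Proof.
move=> p1 /andP[delta0 delta1] /ereal_inf_lt[_ [eps /= eps0 <-]].
move=> /ereal_inf_lt[_ [pi [[pix piy] cxy cyx] <-]].
rewrite unlock; set E := (\int[pi]_w _)%E => hE.
have p0 : 0 < p by exact: lt_le_trans p1.
have E0 : (0 <= E)%E by apply: integral_ge0 => w _; rewrite lee_fin powR_ge0.
have mx : measurable_fun setT (fst : fp_space X * fp_space Y -> _) by exact: measurable_fst.
have my : measurable_fun setT (snd : fp_space X * fp_space Y -> _) by exact: measurable_snd.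
exists _, (fp_space X * fp_space Y)%type, pi, fst, snd, eps; split => //.
- split; first by exists (fun v => (v, point)).
  by exists (fun v => (point, v)).
- rewrite eps0 /= -lte_fin (le_lt_trans _ (lt_le_trans hE _)) //.
    by rewrite leeDr // poweR_ge0.
  by rewrite lee_fin expr2 ler_piMr // ltW.
have mD := measurable_proc_dist mx my.
set A := [set w | _].
have mA : measurable A.
  by rewrite -[X in measurable X]setTI; apply: measurable_fun_ler.
have markov : ((delta `^ p)%:E * pi A <= E)%E.
  rewrite -integral_cst // integral_mkcond; apply: ge0_le_integral => //.
  - by move=> w _; rewrite patchE; case: ifP => // _; rewrite lee_fin powR_ge0.
  - by apply/(measurable_restrictT _ mA)/measurable_cst.
  - by apply/measurable_EFinP; exact: (measurableT_comp (measurable_powR p) mD).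
  - move=> w _; rewrite patchE; case: ifPn => [|_]; last by rewrite lee_fin powR_ge0.
    rewrite inE => /= Aw; rewrite lee_fin ge0_ler_powR ?nnegrE ?(ltW p0) ?(ltW delta0) //.
    exact: le_trans (ltW delta0) Aw.
have {}hE : (E `^ p^-1 < (delta ^+ 2)%:E)%E.
  by apply: le_lt_trans hE; rewrite leeDl.
have [Einf|[r r0 Er]] := (gee0P E).1 E0.
  by move: hE; rewrite Einf poweRyr ?invr_neq0 ?gt_eqF.
move: hE; rewrite Er poweR_EFin lte_fin => hr.
have rp : r <= delta `^ p * delta `^ p.
  rewrite -powRM ?(ltW delta0) // -expr2.
  rewrite (_ : r = (r `^ p^-1) `^ p); last by rewrite -powRrM mulVf ?gt_eqF // powRr1.
  by apply: (ge0_ler_powR (ltW p0) _ _ (ltW hr)); rewrite nnegrE ?powR_ge0 ?sqr_ge0.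
have dp0 : 0 < delta `^ p by rewrite powR_gt0.
have dpd : delta `^ p <= delta.
  rewrite -[leRHS]powRr1 ?(ltW delta0) //; apply: ger_powR => //; first by rewrite delta0.
have piA : pi A \is a fin_num by exact: fin_num_measure.
rewrite -(fineK piA) lee_fin; apply: le_trans dpd.
rewrite -(ler_pM2l dp0) (le_trans _ rp) // -lee_fin EFinM fineK // -Er.
exact: markov.
Qed.

Definition thickening (delta : R) (F : set (cadlag R)) : set (cadlag R) :=
  [set f | exists2 g, F g & d f g < delta].

Lemma open_thickening delta F : open (thickening delta F).
Proof.
apply/(J1_metric_open d_J1) => f [g Fg fg]; exists (delta - d f g).
  by rewrite subr_gt0.
move=> h fh; exists g => //; rewrite (J1_metric_sym d_J1).
rewrite (le_lt_trans (J1_metric_triangle d_J1 _ f _)) //.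
by rewrite (J1_metric_sym d_J1 g f); move: fh; lra.
Qed.

Lemma measurable_open (U : set (cadlag R)) : open U -> measurable U.
Proof. by move=> oU; exact: sub_sigma_algebra. Qed.

Lemma measurable_closed (F : set (cadlag R)) : closed F -> measurable F.
Proof.
by move=> cF; rewrite -[F]setCK; apply: measurableC; apply: measurable_open; exact: closed_openC.
Qed.

Lemma measurable_thickening delta F : measurable (thickening delta F).
Proof. by apply: measurable_open; exact: open_thickening. Qed.

Lemma thickening_mono delta delta' F : delta <= delta' ->
  thickening delta F `<=` thickening delta' F.
Proof. by move=> dd' f [g Fg fg]; exists g => //; exact: lt_le_trans dd'. Qed.

Lemma bigcap_thickening F : closed F ->
  \bigcap_n thickening n.+1%:R^-1 F = F.
Proof.
move=> cF; apply/seteqP; split=> f; last first.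
  move=> Ff n _; exists f => //; rewrite (J1_metric_refl d_J1).
  by rewrite invr_gt0 ltr0n.
move=> Hf; apply: contrapT => nFf.
have [e e0 He] := (J1_metric_open d_J1 (~` F)).1 (closed_openC cF) _ nFf.
have [g Fg fg] := Hf (Num.truncn e^-1) Logic.I.
apply: (He g) => //; apply: lt_le_trans fg _.
by rewrite invf_ple ?posrE ?ltr0n // ltW // truncnS_gt.
Qed.

Lemma thickening_measure_cvg disp (T : measurableType disp) (P : probability T R)
    (V : T -> cadlag R) A F : measurable A -> measurable_fun setT V -> closed F ->
  P (A `&` V @^-1` thickening n.+1%:R^-1 F) @[n --> \oo] --> P (A `&` V @^-1` F).
Proof.
move=> mA mV cF.
have -> : A `&` V @^-1` F = \bigcap_n (A `&` V @^-1` thickening n.+1%:R^-1 F).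
  rewrite -{1}(bigcap_thickening cF); apply/seteqP; split=> w /=.
    by move=> [Aw H] n _; split => //; exact: H.
  by move=> H; split; [case: (H 0%N Logic.I)|move=> n _; case: (H n Logic.I)].
have mn n : measurable (A `&` V @^-1` thickening n.+1%:R^-1 F).
  apply: measurableI => //; rewrite -[X in measurable X]setTI; apply: mV => //.
  exact: measurable_thickening.
apply: (@nonincreasing_cvg_mu _ _ _ P (fun n => A `&` V @^-1` thickening n.+1%:R^-1 F)) => //.
- by rewrite -ge0_fin_numE // fin_num_measure.
- exact: bigcapT_measurable.
- move=> m n mn'; apply/subsetPset => w [Aw Hw]; split=> //.
  apply: thickening_mono Hw; by rewrite lef_pV2 ?posrE ?ltr0n // ler_nat.
Qed.

(** As the total masses agree, the inequality is reversed on open sets. A closed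
    set is the intersection of its open thickenings, which gives the reversed
    inequality for closed sets too. *)
Lemma eq_law_of_closed_le disp1 (T1 : measurableType disp1) (P1 : probability T1 R)
    (V1 : T1 -> cadlag R) A1 disp2 (T2 : measurableType disp2)
    (P2 : probability T2 R) (V2 : T2 -> cadlag R) A2 :
  measurable A1 -> measurable A2 ->
  measurable_fun setT V1 -> measurable_fun setT V2 ->
  P1 A1 = P2 A2 ->
  (forall F, closed F -> (P1 (A1 `&` V1 @^-1` F) <= P2 (A2 `&` V2 @^-1` F))%E) ->
  forall C, measurable C -> P1 (A1 `&` V1 @^-1` C) = P2 (A2 `&` V2 @^-1` C).
Proof.
move=> mA1 mA2 mV1 mV2 PA le12.
have mI d' (T : measurableType d') (V : T -> cadlag R) A C : measurable_fun setT V ->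
    measurable A -> measurable C -> measurable (A `&` V @^-1` C).
  by move=> mV mA mC; apply: measurableI => //; rewrite -[X in measurable X]setTI; exact: mV.
have PC d' (T : measurableType d') (P : probability T R) (V : T -> cadlag R) A C :
    measurable_fun setT V -> measurable A -> measurable C ->
    P (A `&` V @^-1` (~` C)) = (P A - P (A `&` V @^-1` C))%E.
  move=> mV mA mC; rewrite preimage_setC -setDE -[X in _ `\` X](setIidl (@subsetT _ _)).
  have mVC : measurable (V @^-1` C) by rewrite -[X in measurable X]setTI; exact: mV.
  rewrite setIT measureD // -ge0_fin_numE //; exact: fin_num_measure.
have lt12 U : open U -> (P2 (A2 `&` V2 @^-1` U) <= P1 (A1 `&` V1 @^-1` U))%E.
  move=> oU; have mU := measurable_open oU.
  rewrite -[U]setCK PC //; last exact: measurableC.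
  rewrite [leRHS]PC //; last exact: measurableC.
  by rewrite PA leeB // le12 //; exact: open_closedC.
have eqF F : closed F -> P1 (A1 `&` V1 @^-1` F) = P2 (A2 `&` V2 @^-1` F).
  move=> cF; apply/le_anti; rewrite le12 //=.
  have c1 := thickening_measure_cvg (P := P1) mA1 mV1 cF.
  apply: (cvge_to_ge c1); near=> n.
  have := lt12 _ (@open_thickening n.+1%:R^-1 F); apply: le_trans.
  apply: le_measure; rewrite ?inE; [exact: mI (measurable_closed cF)|
    exact: mI (@measurable_thickening _ _)|].
  move=> w [Aw Fw]; split=> //; exists (V2 w) => //.
  by rewrite (J1_metric_refl d_J1) invr_gt0 ltr0n.
have eqU U : open U -> P1 (A1 `&` V1 @^-1` U) = P2 (A2 `&` V2 @^-1` U).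
  move=> oU; have cU : closed (~` U) by exact: open_closedC.
  rewrite -[U]setCK PC //; last exact: measurable_closed.
  by rewrite [RHS]PC ?eqF ?PA //; exact: measurable_closed.
move=> C mC.
pose m1 := pushforward (mrestr P1 mA1) V1; pose m2 := pushforward (mrestr P2 mA2) V2.
have m1E D : m1 D = P1 (A1 `&` V1 @^-1` D) by exact: (congr1 P1 (setIC _ _)).
have m2E D : m2 D = P2 (A2 `&` V2 @^-1` D) by exact: (congr1 P2 (setIC _ _)).
suff : m1 C = m2 C by rewrite m1E m2E.
apply: (@measure_unique _ R _ (@open (cadlag R)) (fun=> setT)) => //.
- exact: openI.
- by move=> _; exact: openT.
- by apply/seteqP; split=> // f _; exists 0%N.
- move=> U oU; transitivity (m1 U) => //; transitivity (m2 U) => //.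
  by rewrite m1E m2E; exact: eqU.
- move=> _; apply: (@le_lt_trans _ _ (m1 setT)) => //; rewrite m1E preimage_setT setIT.
  by rewrite -ge0_fin_numE // fin_num_measure.
Unshelve. all: by end_near. Qed.

End close_processes.

(** * Removing the delay *)

Section lower_limit.
Context {R : realType}.

(** The limit inferior of a bounded sequence; unlike a limit it is defined for
    every outcome, and it preserves monotonicity and measurability. *)
Definition lower_limit (u : nat -> R) : R :=
  sup [set c | exists N, forall k, (N <= k)%N -> c <= u k].

Variable u : nat -> R.
Hypothesis u01 : forall k, 0 <= u k <= 1.

Let has_sup_lower : has_sup [set c | exists N, forall k, (N <= k)%N -> c <= u k].
Proof.
split; first by exists 0, 0%N => k _; case/andP: (u01 k).
exists 1 => c [N /(_ _ (leqnn N)) cu]; apply: le_trans cu _.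
by case/andP: (u01 N).
Qed.

Lemma lower_limit_gt c : c < lower_limit u <->
  exists N m, forall k, (N <= k)%N -> c + m.+1%:R^-1 <= u k.
Proof.
split=> [|[N [m H]]].
  move=> /sup_gt[|c' [N H] cc']; first by case: has_sup_lower.
  have c0 : 0 < c' - c by rewrite subr_gt0.
  exists N, (Num.truncn (c' - c)^-1) => k /H; apply: le_trans.
  rewrite -lerBrDl invf_ple ?posrE ?ltr0n // ltW // truncnS_gt //.
apply: (@lt_le_trans _ _ (c + m.+1%:R^-1)); first by rewrite ltrDl invr_gt0 ltr0n.
by apply: ub_le_sup; [case: has_sup_lower|exists N].
Qed.

Lemma lower_limit01 : 0 <= lower_limit u <= 1.
Proof.
apply/andP; split.
  apply: ub_le_sup; first by case: has_sup_lower.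
  by exists 0%N => k _; case/andP: (u01 k).
apply: ge_sup; first by case: has_sup_lower.
move=> c [N /(_ _ (leqnn N)) cu]; apply: le_trans cu _.
by case/andP: (u01 N).
Qed.

Lemma lower_limit_cvg : cvgn u -> u k @[k --> \oo] --> lower_limit u.
Proof.
move=> /cvg_ex[l ul]; suff -> : lower_limit u = l by [].
apply/le_anti/andP; split.
  rewrite leNgt; apply/negP => /lower_limit_gt[N [m H]].
  have m0 : 0 < m.+1%:R^-1 :> R by rewrite invr_gt0 ltr0n.
  move/cvgrPdist_lt: ul => /(_ _ m0)[M _ /(_ (maxn N M))].
  rewrite /= leq_maxr => /(_ isT); rewrite distrC => /(le_lt_trans (ler_norm _)).
  have := H _ (leq_maxl N M); move: (m.+1%:R^-1) => y; lra.
apply/ler_addgt0Pr => e e0; rewrite -lerBlDr.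
apply: ub_le_sup; first by case: has_sup_lower.
move/cvgrPdist_lt: ul => /(_ _ e0)[M _ HM]; exists M => k /HM /=.
by move=> /(le_lt_trans (ler_norm _)); lra.
Qed.

End lower_limit.

Lemma lower_limit_le {R : realType} (u v : nat -> R) :
  (forall k, 0 <= u k <= 1) -> (forall k, 0 <= v k <= 1) ->
  (forall k, u k <= v k) -> lower_limit u <= lower_limit v.
Proof.
move=> u01 v01 uv; rewrite leNgt; apply/negP => vu.
have [N [m H]] := (lower_limit_gt u01 _).1 vu.
suff : lower_limit v < lower_limit v by rewrite ltxx.
apply/(lower_limit_gt v01); exists N, m => k Nk.
exact: le_trans (H _ Nk) (uv k).
Qed.

Section limit_of_close.
Variables (R : realType) (d : cadlag R -> cadlag R -> R).
Hypothesis d_J1 : J1_metric d.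
Variables X Y : filtered_process R.
Hypothesis XY : forall delta, 0 < delta <= 1 -> close d delta X Y.
Local Notation PX := (fp_prob X).
Local Notation PY := (fp_prob Y).

Let inv01 n : 0 < (n.+1%:R^-1 : R) <= 1.
Proof. by rewrite invr_gt0 ltr0n invf_le1 ?ltr0n // ler1n. Qed.

Let inv_mono m n : (m <= n)%N -> n.+1%:R^-1 <= m.+1%:R^-1 :> R.
Proof. by move=> mn; rewrite lef_pV2 ?posrE ?ltr0n // ler_nat. Qed.

Let mX : measurable_fun setT (fp_proc X). Proof. exact: (measurable_fp_proc d_J1). Qed.
Let mY : measurable_fun setT (fp_proc Y). Proof. exact: (measurable_fp_proc d_J1). Qed.

Let mXC C : measurable C -> measurable (fp_proc X @^-1` C).
Proof. by move=> mC; rewrite -[X in measurable X]setTI; exact: mX. Qed.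

Let mYC C : measurable C -> measurable (fp_proc Y @^-1` C).
Proof. by move=> mC; rewrite -[X in measurable X]setTI; exact: mY. Qed.

(** Where the two paths are delta-close, Y in F forces X into the thickening. *)
Lemma coupling_close_le disp (T : measurableType disp) (pi : probability T R)
    (x : T -> fp_space X) (y : T -> fp_space Y) delta A F :
  measurable_fun setT x -> measurable_fun setT y ->
  (forall B, measurable B -> pushforward pi x B = PX B) ->
  (pi [set w | delta <= d (fp_proc X (x w)) (fp_proc Y (y w))]%R <= delta%:E)%E ->
  measurable A -> closed F ->
  (pi (x @^-1` A `&` y @^-1` (fp_proc Y @^-1` F)) <=
   PX (A `&` fp_proc X @^-1` thickening d delta F) + delta%:E)%E.
Proof.
move=> mx my pix pid mA cF.
have mxA B : measurable B -> measurable (x @^-1` B).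
  by move=> mB; rewrite -[X in measurable X]setTI; exact: mx.
have mth : measurable (A `&` fp_proc X @^-1` thickening d delta F).
  by apply: measurableI => //; apply: mXC; exact: (@measurable_thickening _ _ d_J1).
rewrite -pix // /pushforward.
set D := [set w | _] in pid *.
have mD : measurable D.
  rewrite -[X in measurable X]setTI; apply: measurable_fun_ler => //.
  exact: measurable_proc_dist.
apply: (@le_trans _ _ (pi (x @^-1` (A `&` fp_proc X @^-1` thickening d delta F) `|` D))).
  apply: le_measure; rewrite ?inE.
  - apply: measurableI; first exact: mxA.
    rewrite -[X in measurable X]setTI; apply: my => //; apply: mYC.
    exact: measurable_closed.
  - by apply: measurableU => //; exact: mxA.
  - move=> w [Aw Fw]; have [Dw|nDw] := pselect (D w); first by right.
    left; split=> //; exists (fp_proc Y (y w)) => //.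
    by rewrite ltNge; apply/negP.
apply: (@le_trans _ _ (pi (x @^-1` (A `&` fp_proc X @^-1` thickening d delta F)) + pi D)%E).
  by apply: measureU2 => //; exact: mxA.
by rewrite leeD2l.
Qed.

Lemma limit_closed_le c A F : measurable A -> closed F ->
  (forall n, c <= PX (A `&` fp_proc X @^-1` thickening d n.+1%:R^-1 F) + (n.+1%:R^-1)%:E)%E ->
  (c <= PX (A `&` fp_proc X @^-1` F))%E.
Proof.
move=> mA cF H.
have c1 := thickening_measure_cvg d_J1 (P := PX) mA mX cF.
have c2 : (n.+1%:R^-1)%:E @[n --> \oo] --> (0 : R)%:E.
  by apply: cvg_EFin; [exact: nearW|exact: cvg_harmonic].
have z_fin : ((0 : R)%:E : \bar R) \is a fin_num by [].
have c3 := cvgeD (fin_num_adde_defl (PX (A `&` fp_proc X @^-1` F)) z_fin) c1 c2.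
rewrite -[leRHS]adde0; apply: (cvge_to_ge (c3 _)); exact: nearW.
Qed.

Lemma close_eq_law C : measurable C -> PY (fp_proc Y @^-1` C) = PX (fp_proc X @^-1` C).
Proof.
move=> mC.
have := @eq_law_of_closed_le _ _ d_J1 _ _ PY (fp_proc Y) setT _ _ PX (fp_proc X) setT.
move=> /(_ measurableT measurableT mY mX _ _ C mC); rewrite !setTI; apply.
  transitivity (1%E : \bar R); last exact/esym/probability_setT.
  exact: probability_setT.
move=> F cF; apply: limit_closed_le => // n.
have [disp [T [pi [x [y [eps [[mx my pix piy] _ _ _ hd]]]]]]] := XY (inv01 n).
have := coupling_close_le mx my pix hd measurableT cF.
rewrite preimage_setT !setTI; apply: le_trans.
rewrite -piy //; apply: mYC; exact: measurable_closed.
Qed.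

Variable tau : fp_space X -> R.
Hypothesis tauP : stopping_time tau.
Let A (q : rat) := [set w | tau w <= ratr q].

Let mA q : measurable (A q).
Proof.
rewrite -[X in measurable X]setTI; apply: measurable_fun_ler => //.
exact: measurable_stopping_time tauP.
Qed.

(** The constraints met by the distribution functions of tau seen through a
    coupling whose delay and distance are at most 1 / (n + 1). They are convex
    in z. *)
Let approx (n : nat) : set (rat -> fp_space Y -> R) := [set z |
  [/\ delayed_cdf n.+1%:R^-1 z,
      forall q, 0 <= q < 1 -> measurable_fun setT (z q),
      forall q, 0 <= q < 1 -> (\int[PY]_w (z q w)%:E = PX (A q))%E &
      forall q F, 0 <= q < 1 -> closed F ->
        (\int[PY]_(w in fp_proc Y @^-1` F) (z q w)%:E <=
         PX (A q `&` fp_proc X @^-1` thickening d n.+1%:R^-1 F) + (n.+1%:R^-1)%:E)%E]].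

Let delayed_cdf_le (e e' : R) z : e <= e' -> delayed_cdf (Y := Y) e z -> delayed_cdf e' z.
Proof.
move=> ee' [h1 h2 h3]; split=> // q s q01 /andP[qs s1]; apply: h3 => //.
by rewrite s1 (le_lt_trans _ qs) // lerD2l.
Qed.

Let approx_neq0 n : approx n !=set0.
Proof.
have [disp [T [pi [x [y [eps [[mx my pix piy] [_ [s ys]] /andP[eps0 eps1] [_ ci] hd]]]]]]]
  := XY (inv01 n).
have [Z [hZ mZ ZE]] := causal_delayed_cdf mx my ys piy eps0 ci tauP.
exists Z; split => //.
- by apply: delayed_cdf_le hZ; exact: ltW.
- move=> q q01; rewrite ZE //; last first.
    by rewrite -(preimage_setT (fp_proc Y)); exact: (fp_filt1_preimage d_J1).
  by rewrite preimage_setT setIT -pix.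
- move=> q F q01 cF; rewrite ZE //; last first.
    by apply: (fp_filt1_preimage d_J1); exact: measurable_closed.
  exact: (coupling_close_le mx my pix hd (mA q) cF).
Qed.

Let approx_decr m n : (m <= n)%N -> approx n `<=` approx m.
Proof.
move=> mn z [h1 h2 h3 h4]; split=> //.
  by apply: delayed_cdf_le h1; exact: inv_mono.
move=> q F q01 cF; apply: le_trans (h4 q F q01 cF) _; apply: leeD.
  have mt e : measurable (A q `&` fp_proc X @^-1` thickening d e F).
    by apply: measurableI => //; apply: mXC; exact: (@measurable_thickening _ _ d_J1).
  apply: le_measure; rewrite ?inE //.
  by move=> w [Aw Fw]; split=> //; apply: thickening_mono Fw; exact: inv_mono.
by rewrite lee_fin inv_mono.
Qed.

Let int_mid (a b : fp_space Y -> R) B : measurable B ->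
  measurable_fun setT a -> measurable_fun setT b ->
  (forall w, 0 <= a w <= 1) -> (forall w, 0 <= b w <= 1) ->
  (\int[PY]_(w in B) ((a w + b w) / 2)%:E =
   (2^-1)%:E * (\int[PY]_(w in B) (a w)%:E + \int[PY]_(w in B) (b w)%:E))%E.
Proof.
move=> mB ma mb a01 b01.
have a0 w : 0 <= a w by case/andP: (a01 w).
have b0 w : 0 <= b w by case/andP: (b01 w).
have mEa : measurable_fun B (EFin \o a) by apply/measurable_EFinP; exact: measurable_funTS.
have mEb : measurable_fun B (EFin \o b) by apply/measurable_EFinP; exact: measurable_funTS.
rewrite -ge0_integralD //; try by move=> w _; rewrite lee_fin.
rewrite -ge0_integralZl //.
- by apply: eq_integral => w _; rewrite -EFinD -EFinM mulrC.
- by apply: emeasurable_funD.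
- by move=> w _; rewrite -EFinD lee_fin addr_ge0.
Qed.

Let half_sum (c : \bar R) : ((2^-1)%:E * (c + c) = c)%E.
Proof.
case: c => [r| |]; rewrite /= ?gt0_muley ?gt0_muleNy ?lte_fin //.
by rewrite -EFinD -EFinM; congr EFin; field.
Qed.

Let approx_mid n a b : approx n a -> approx n b ->
  approx n (fun q w => (a q w + b q w) / 2).
Proof.
move=> [[a1 a2 a3] ma Ia Fa] [[b1 b2 b3] mb Ib Fb]; split; first split.
- move=> q w; have /andP[x0 x1] := a1 q w; have /andP[y0 y1] := b1 q w.
  by apply/andP; split; lra.
- move=> q r w q0 qr r1; have := a2 q r w q0 qr r1; have := b2 q r w q0 qr r1; lra.
- move=> q s q01 hs; have /andP[qs s1] := hs.
  have s01 : 0 <= s <= 1.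
    rewrite s1 andbT (le_trans _ (ltW qs)) // addr_ge0 // ler0q.
    by case/andP: q01.
  have sG := @fp_filt_sigma _ Y s s01.
  apply/(sub_measurableP sG); apply: measurable_funM => //.
  by apply: measurable_funD; apply/(sub_measurableP sG); [exact: a3|exact: b3].
- move=> q q01; apply: measurable_funM => //.
  by apply: measurable_funD; [exact: ma|exact: mb].
- by move=> q q01; rewrite (int_mid measurableT (ma q q01) (mb q q01) (a1 q) (b1 q)) Ia // Ib // half_sum.
- move=> q F q01 cF; have mF := mYC (measurable_closed cF).
  rewrite (int_mid mF (ma q q01) (mb q q01) (a1 q) (b1 q)).
  rewrite -[leRHS]half_sum lee_pmul2l //; first by apply: leeD; [exact: Fa|exact: Fb].
Qed.

Let times (n : nat) : rat :=
  if @unpickle rat n is Some q then if 0 <= q < 1 then q else 0 else 0.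

Let times01 n : 0 <= times n < 1.
Proof. by rewrite /times; case: unpickle => [q|] //; case: ifP. Qed.

Let times_pickle (q : rat) : 0 <= q < 1 -> times (pickle q) = q.
Proof. by move=> q01; rewrite /times pickleK q01. Qed.

(** The limit of elements of approx n is measurable at all times after q, so it
    has no delay, and it inherits the inequalities on closed sets; since the
    total mass P(tau <= q) is prescribed, these become equalities. *)
Lemma exists_limit_cdf : exists Z : rat -> fp_space Y -> R,
  [/\ delayed_cdf 0 Z, forall q, 0 <= q < 1 -> measurable_fun setT (Z q) &
      forall q C, 0 <= q < 1 -> measurable C ->
        (\int[PY]_(w in fp_proc Y @^-1` C) (Z q w)%:E =
         PX (fp_proc X @^-1` C `&` A q))%E].
Proof.
have [z [zK zcvg]] := @exists_ae_cvg_sequence R _ _ PY rat times approx approx_neq0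
  approx_decr approx_mid
  (fun n z i (h : approx n z) => let: And4 _ mz _ _ := h in mz _ (times01 i))
  (fun n z i w (h : approx n z) => let: And4 (And3 z01 _ _) _ _ _ := h in z01 _ w).
pose Z q w := lower_limit (fun k => z k q w).
have z01 k q w : 0 <= z k q w <= 1 by case: (zK k) => -[].
have ZF q s : 0 <= q < 1 -> ratr q < s <= 1 -> sub_measurable (fp_filt Y s) (Z q).
  move=> q01 /andP[qs s1]; have /andP[q0 _] := q01.
  have s01 : 0 <= s <= 1 by rewrite s1 andbT (le_trans _ (ltW qs)) // ler0q.
  have sG := @fp_filt_sigma _ Y s s01.
  have sq0 : 0 < s - ratr q by rewrite subr_gt0.
  pose k0 := Num.truncn (s - ratr q)^-1.
  have hk0 k : (k0 < k)%N -> ratr q + k.+1%:R^-1 < s.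
    move=> k0k; rewrite -ltrBrDl invf_plt ?posrE ?ltr0n //.
    by rewrite (lt_le_trans (truncnS_gt _)) // ler_nat ltnW.
  apply: sub_measurable_gt => // c.
  suff : measurable ([set w | c < Z q w] : set (g_sigma_algebraType (fp_filt Y s))).
    by rewrite {1}/measurable /= sigma_algebra_id.
  (* Only the terms after k0, whose delay is less than s - q, are involved. *)
  rewrite (_ : mkset _ = \bigcup_N \bigcup_m
      \bigcap_(k in [set k | (maxn N k0.+1 <= k)%N]) [set w | c + m.+1%:R^-1 <= z k q w]).
    apply: bigcupT_measurable => N; apply: bigcupT_measurable => m.
    apply: bigcap_measurable; first by exists (maxn N k0.+1) => /=.
    move=> k /=; rewrite geq_max => /andP[_ k0k].
    rewrite (_ : mkset _ = z k q @^-1` `[c + m.+1%:R^-1, +oo[%classic); last first.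
      by apply/seteqP; split=> w /=; rewrite in_itv /= andbT.
    rewrite /measurable /= sigma_algebra_id //.
    have [[_ _ h3] _ _ _] := zK k; apply: (h3 q s q01) => //.
    by rewrite s1 andbT; exact: hk0.
  apply/seteqP; split=> w /=.
    move=> /(lower_limit_gt (fun k => z01 k q w))[N [m H]].
    by exists N => //; exists m => // k /=; rewrite geq_max => /andP[/H].
  move=> [N _ [m _ H]]; apply/(lower_limit_gt (fun k => z01 k q w)).
  by exists (maxn N k0.+1), m.
have mZ q : 0 <= q < 1 -> measurable_fun setT (Z q).
  move=> q01; have /andP[q0 q1] := q01.
  apply: (@sub_measurable_measurable _ _ R (fp_filt Y 1)).
    by apply: (@fp_filt_sub _ Y 1); rewrite ler01 lexx.
  by apply: ZF => //; rewrite lexx andbT -[ltRHS](rmorph1 (@ratr R)) ltr_rat.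
have Zcvg q B : 0 <= q < 1 -> measurable B ->
    (\int[PY]_(w in B) (z k q w)%:E)%E @[k --> \oo] --> (\int[PY]_(w in B) (Z q w)%:E)%E.
  move=> q01 mB.
  have [] := @dominated_convergence _ _ _ PY B mB (fun k w => (z k q w)%:E)
    (fun w => (Z q w)%:E) (EFin \o cst 1).
  - move=> k; apply/measurable_EFinP; apply: measurable_funTS.
    by case: (zK k) => _ h _ _; exact: h.
  - by apply/measurable_EFinP; apply: measurable_funTS; exact: mZ.
  - have := zcvg (pickle (q : rat)); rewrite times_pickle //; apply: filterS => w cw _.
    apply: cvg_EFin; first exact: nearW.
    exact: (lower_limit_cvg (fun k => z01 k q w) cw).
  - apply: (integrableS measurableT mB (@subsetT _ _)).
    exact: finite_measure_integrable_cst.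
  - apply: aeW => w n _; rewrite /= lee_fin; case/andP: (z01 n q w) => h0 h1.
    by rewrite ger0_norm.
  by move=> _ _.
have Zmass q : 0 <= q < 1 -> (\int[PY]_w (Z q w)%:E = PX (A q))%E.
  move=> q01; have c1 := Zcvg q setT q01 measurableT.
  apply: (cvg_unique _ c1) => //.
  rewrite (_ : (fun k => _) = cst (PX (A q))); first exact: cvg_cst.
  by apply/funext => k; case: (zK k) => _ _ -> .
have Zclosed q F : 0 <= q < 1 -> closed F ->
    (\int[PY]_(w in fp_proc Y @^-1` F) (Z q w)%:E <= PX (A q `&` fp_proc X @^-1` F))%E.
  move=> q01 cF; apply: limit_closed_le => // n.
  have c1 := Zcvg q _ q01 (mYC (measurable_closed cF)).
  apply: (cvge_to_le c1); exists n => // k /= nk.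
  by have [_ _ _ h] := approx_decr nk (zK k); exact: h.
exists Z; split => //.
  split.
  - by move=> q w; exact: lower_limit01.
  - move=> q r w q0 qr r1; apply: lower_limit_le => // k.
    by case: (zK k) => -[_ h _] _ _ _; exact: h.
  - by move=> q s q01; rewrite addr0; exact: ZF.
move=> q C q01 mC.
pose S := [set v : fp_space Y * measurableTypeR R | v.2 < Z q v.1].
have mS : measurable S by exact: measurable_subgraph (mZ q q01).
pose mu : probability (fp_space Y * measurableTypeR R)%type R := (PY \x unif R)%E.
have mY1 : measurable_fun setT (fun v : fp_space Y * measurableTypeR R => fp_proc Y v.1).
  by apply: measurableT_comp.
have muS B : mu (S `&` (fun v => fp_proc Y v.1) @^-1` B) =
    (\int[PY]_(w in fp_proc Y @^-1` B) (Z q w)%:E)%E.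
  rewrite setIC; apply: (product_unif_subgraph PY (fp_proc Y @^-1` B)) => w.
  exact: lower_limit01.
rewrite -muS [RHS](_ : _ = PX (A q `&` fp_proc X @^-1` C)); last by rewrite setIC.
apply: (@eq_law_of_closed_le _ _ d_J1 _ _ mu _ S _ _ PX _ (A q)) => //.
  have := muS setT; rewrite preimage_setT setIT => ->.
  by rewrite preimage_setT Zmass.
by move=> F cF; rewrite muS Zclosed.
Qed.

Variables (phi : cadlag R * R -> R) (M : R).
Hypothesis mphi : measurable_fun setT
  (fun z : cadlag R * R => phi (z.1, clamp01 z.2)).
Hypothesis phiM : forall f t, 0 <= t <= 1 -> `|phi (f, t)| <= M.

Lemma OS_le_reward_of_close :
  (OS Y phi <= \int[PX]_w (phi (fp_proc X w, tau w))%:E)%E.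
Proof.
have [Z [hZ mZ ZE]] := exists_limit_cdf.
have tau01 w : 0 <= tau w <= 1 by case: tauP.
have := OS_le_randomized d_J1 (lexx 0) hZ mZ mX (measurable_stopping_time tauP)
  tau01 ZE close_eq_law mphi phiM.
by under eq_integral do rewrite addr0 clamp01_id //.
Qed.

End limit_of_close.

Lemma OS_le_of_close {R : realType} (d : cadlag R -> cadlag R -> R) (d_J1 : J1_metric d)
    (X Y : filtered_process R) (phi : cadlag R * R -> R) (M : R) :
  measurable_fun setT (fun z : cadlag R * R => phi (z.1, clamp01 z.2)) ->
  (forall f t, 0 <= t <= 1 -> `|phi (f, t)| <= M) ->
  (forall delta, 0 < delta <= 1 -> close d delta X Y) ->
  (OS Y phi <= OS X phi)%E.
Proof.
move=> mphi phiM XY; apply/ereal_infP => _ [tau tauP <-]; rewrite unlock.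
exact: (OS_le_reward_of_close d_J1 XY tauP mphi phiM).
Qed.

(** * Continuous rewards *)

Section coupling_bound.
Context {R : realType} (d : cadlag R -> cadlag R -> R).
Hypothesis d_J1 : J1_metric d.
Variables (phi : cadlag R * R -> R) (M : R).
Hypothesis mphi : measurable_fun setT
  (fun z : cadlag R * R => phi (z.1, clamp01 z.2)).
Hypothesis phiM : forall f t, 0 <= t <= 1 -> `|phi (f, t)| <= M.

Lemma OS_le_causal (X Y : filtered_process R) disp (T : measurableType disp)
    (pi : probability T R) (x : T -> fp_space X) (y : T -> fp_space Y) eps tau :
  measurable_fun setT x -> measurable_fun setT y -> (exists s, cancel s y) ->
  (forall B, measurable B -> pushforward pi y B = fp_prob Y B) ->
  0 <= eps -> causal pi y x eps -> stopping_time (X := X) tau ->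
  (OS Y phi <= \int[pi]_w (phi (fp_proc Y (y w), clamp01 (tau (x w) + eps)))%:E)%E.
Proof.
move=> mx my [s ys] piy eps0 ci tauP.
have mY : measurable_fun setT (fp_proc Y) by exact: (measurable_fp_proc d_J1).
have [Z [hZ mZ ZE]] := causal_delayed_cdf mx my ys piy eps0 ci tauP.
apply: (OS_le_randomized d_J1 eps0 hZ mZ (P' := pi)
  (V := fun w => fp_proc Y (y w)) (th := fun w => tau (x w)) _ _ _ _ _ mphi phiM).
- exact: measurableT_comp.
- by apply: measurableT_comp => //; exact: measurable_stopping_time tauP.
- by move=> w; case: tauP.
- move=> q C q01 mC; rewrite ZE //; last exact: (fp_filt1_preimage d_J1).
  by rewrite setIC.
- move=> C mC; rewrite -piy //; rewrite -[X in measurable X]setTI; exact: mY.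
Qed.

Lemma integral_le_up_to {disp} {T : measurableType disp} (P : probability T R)
    (F G : T -> R) (B : set T) eta :
  measurable_fun setT F -> measurable_fun setT G -> measurable B ->
  (forall w, `|F w| <= M) -> (forall w, `|G w| <= M) ->
  0 <= eta -> (forall w, ~ B w -> F w <= G w + eta) ->
  (\int[P]_w (F w)%:E <= \int[P]_w (G w)%:E + (eta + 2 * M * fine (P B))%:E)%E.
Proof.
move=> mF mG mB FM GM eta0 FG.
have M0 : 0 <= M by apply: le_trans (FM point).
have IG := bounded_integrable P mG GM.
have IF := bounded_integrable P mF FM.
pose H w := eta + 2 * M * \1_B w.
have mH : measurable_fun setT H by apply: measurable_funD => //; exact: measurable_funM.
have IH : P.-integrable setT (EFin \o H).
  apply: (bounded_integrable P mH (M := eta + 2 * M)) => w.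
  rewrite ger0_norm /H indicE; first by rewrite lerD2l ler_piMr ?mulr_ge0 // lern1 leq_b1.
  by rewrite addr_ge0 // mulr_ge0 // mulr_ge0.
have HE : (\int[P]_w (H w)%:E = (eta + 2 * M * fine (P B))%:E)%E.
  rewrite (_ : (fun w => (H w)%:E) = (fun w => eta%:E + (2 * M * \1_B w)%:E)%E) //.
  rewrite ge0_integralD //.
  - have -> : (\int[P]_x eta%:E = eta%:E)%E.
      rewrite [LHS](integral_cst P measurableT eta%:E).
      by rewrite [X in (_ * X)%E](_ : _ = 1%E) ?mule1 //; exact: probability_setT.
    under eq_integral do rewrite EFinM.
    rewrite ge0_integralZl //.
    + rewrite integral_indic // setIT EFinD [X in (_ = _ + X)%E]EFinM fineK //.
      exact: fin_num_measure.
    + by apply/measurable_EFinP; exact: measurable_indic.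
    + by rewrite lee_fin mulr_ge0.
  - by move=> w _; rewrite lee_fin !mulr_ge0.
  - by apply/measurable_EFinP; exact: measurable_funM.
rewrite -HE -integralD //; apply: le_integral => //; first exact: integrableD.
move=> w _; rewrite lee_fin /H indicE.
have [Bw|nBw] := pselect (B w); last by rewrite memNset // mulr0 addr0 FG.
rewrite mem_set // mulr1.
have := FM w; have := GM w; rewrite !ler_norml => /andP[g1 _] /andP[_ f2]; lra.
Qed.

End coupling_bound.

Section continuous_reward.
Context {R : realType} (d : cadlag R -> cadlag R -> R).
Hypothesis d_J1 : J1_metric d.
Variables (phi : cadlag R * R -> R) (M : R).
Hypothesis mphi : measurable_fun setT
  (fun z : cadlag R * R => phi (z.1, clamp01 z.2)).
Hypothesis phiM : forall f t, 0 <= t <= 1 -> `|phi (f, t)| <= M.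
Hypothesis phi_cont : {within path_time R, continuous phi}.

Lemma reward_modulus f t eta : 0 <= t <= 1 -> 0 < eta -> exists2 r : R, 0 < r &
  forall g s, 0 <= s <= 1 -> d f g < r -> `|s - t| < r ->
    `|phi (g, s) - phi (f, t)| < eta.
Proof.
move=> t01 eta0.
have pt : path_time R (f, t) by split => //=; rewrite in_itv.
have := (subspace_continuousP _ _).1 phi_cont _ pt.
move=> /cvgrPdist_lt/(_ _ eta0)[[U V] /= [Uf Vt] UV].
have [W [oW Wf] WU] : exists2 W : set (cadlag R), open_nbhs f W & W `<=` U.
  by move: Uf; rewrite nbhsE.
have [r1 r10 h1] := (J1_metric_open d_J1 W).1 oW f Wf.
have [r2 /= r20 h2] := (nbhs_ballP _ _).1 Vt.
exists (Num.min r1 r2); first by rewrite lt_min r10.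
move=> g s s01; rewrite !lt_min => /andP[fg _] /andP[_ st]; rewrite distrC.
apply: (UV (g, s)) => /=; last by split => //=; rewrite in_itv.
by split; [apply: WU; exact: h1|apply: h2; rewrite /ball /= distrC].
Qed.

(** The times are existentially quantified: nothing is known about the stopping
    time of the process that varies, only the path of the fixed process is under
    control. *)
Definition oscillating (eta delta : R) : set (cadlag R) :=
  [set f | exists g s t, [/\ 0 <= s <= 1, 0 <= t <= 1, d f g < delta,
     `|s - t| < delta & eta < `|phi (g, s) - phi (f, t)|]].

Lemma open_oscillating eta delta : open (oscillating eta delta).
Proof.
apply/(J1_metric_open d_J1) => f [g [s [t [s01 t01 fg st pe]]]].
have e0 : 0 < `|phi (g, s) - phi (f, t)| - eta by rewrite subr_gt0.
have [r r0 Hr] := reward_modulus f t01 e0.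
exists (Num.min r (delta - d f g)); first by rewrite lt_min r0 subr_gt0.
move=> h; rewrite lt_min => /andP[fhr fhd]; exists g, s, t; split=> //.
  rewrite (le_lt_trans (J1_metric_triangle d_J1 _ f _)) //.
  by rewrite (J1_metric_sym d_J1 h f) -ltrBrDr.
have := Hr h t t01 fhr; rewrite subrr normr0 => /(_ r0).
have : `|phi (g, s) - phi (f, t)| <= `|phi (g, s) - phi (h, t)| + `|phi (h, t) - phi (f, t)|.
  exact: ler_distD.
lra.
Qed.

Lemma oscillating_le eta delta delta' : delta <= delta' ->
  oscillating eta delta `<=` oscillating eta delta'.
Proof.
move=> dd' f [g [s [t [s01 t01 fg st pe]]]]; exists g, s, t; split=> //;
  exact: lt_le_trans dd'.
Qed.

(** At a cluster point of the witnessing times, phi would be discontinuous. *)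
Lemma bigcap_oscillating eta : 0 < eta ->
  \bigcap_n oscillating eta n.+1%:R^-1 = set0.
Proof.
move=> eta0; apply/seteqP; split=> // f Hf.
have /choice[g] n : exists g, exists s t, [/\ 0 <= s <= 1, 0 <= t <= 1,
    d f g < n.+1%:R^-1, `|s - t| < n.+1%:R^-1 & eta < `|phi (g, s) - phi (f, t)|].
  exact: Hf.
move=> /choice[s] /choice[t] H.
have F01 : (t @ \oo) `[0, 1]%classic.
  by exists 0%N => // n _ /=; rewrite in_itv /=; case: (H n).
have [l [/= l01 cl]] := @segment_compact R 0 1 (t @ \oo) _ F01.
rewrite in_itv /= in l01.
have eta20 : 0 < eta / 2 by rewrite divr_gt0.
have [r r0 Hr] := reward_modulus f l01 eta20.
pose N := Num.truncn (r / 2)^-1.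
have hN n : (N <= n)%N -> n.+1%:R^-1 <= r / 2.
  move=> Nn; rewrite invf_ple ?posrE ?ltr0n ?divr_gt0 //.
  by rewrite ltW // (lt_le_trans (truncnS_gt _)) // ler_nat ltnS.
have r20 : 0 < r / 2 by rewrite divr_gt0.
have [||u [[n Nn <-] /= tl]] := cl [set t n | n in [set n | (N <= n)%N]] (ball l (r / 2)).
- by exists N => // n /= Nn; exists n.
- exact: nbhsx_ballx.
have [s01 t01 dg st pe] := H n; have := hN n Nn => nr.
rewrite /ball /= in tl.
have rr : r / 2 < r by rewrite ltr_pdivrMr // ltr_pMr // ltr1n.
have h1 := Hr (g n) (s n) s01.
have h2 := Hr f (t n) t01.
have dgr : d f (g n) < r by rewrite (lt_le_trans dg) // (le_trans nr) // ltW.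
have tr : `|t n - l| < r by rewrite distrC (lt_trans tl).
have sr : `|s n - l| < r.
  rewrite (le_lt_trans (ler_distD (t n) _ _)) // (splitr r) ltrD //.
    exact: lt_le_trans st nr.
  by rewrite distrC.
have {h1} h1 := h1 dgr sr.
have {h2} h2 := h2 _ tr.
rewrite (J1_metric_refl d_J1) in h2; have {h2} h2 := h2 r0.
have := ler_distD (phi (f, l)) (phi (g n, s n)) (phi (f, t n)).
rewrite (distrC (phi (f, l))); lra.
Qed.

Lemma oscillating_small (X : filtered_process R) eta e : 0 < eta -> 0 < e ->
  exists2 delta : R, 0 < delta <= e &
    fine (fp_prob X (fp_proc X @^-1` oscillating eta delta)) <= e.
Proof.
move=> eta0 e0; have mX : measurable_fun setT (fp_proc X) by exact: (measurable_fp_proc d_J1).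
pose B n := fp_proc X @^-1` oscillating eta n.+1%:R^-1.
have mB n : measurable (B n).
  rewrite -[X in measurable X]setTI; apply: mX => //.
  by apply: measurable_open; exact: open_oscillating.
have capB : \bigcap_n B n = set0.
  apply/seteqP; split=> // w Hw.
  have : (\bigcap_n oscillating eta n.+1%:R^-1) (fp_proc X w) by move=> n _; exact: Hw.
  by rewrite bigcap_oscillating.
have cB : (fp_prob X \o B) n @[n --> \oo] --> fp_prob X (\bigcap_n B n).
  apply: nonincreasing_cvg_mu => //.
  - by rewrite -ge0_fin_numE // fin_num_measure.
  - exact: bigcapT_measurable.
  - move=> m n mn; apply/subsetPset => w; apply: oscillating_le.
    by rewrite lef_pV2 ?posrE ?ltr0n // ler_nat.
rewrite capB measure0 in cB.
have lt_e : nbhs (0%E : \bar R) [set u | (u < e%:E)%E].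
  by apply: open_ereal_lt'; rewrite lte_fin.
have [N _ HN] := cB _ lt_e.
pose n := maxn N (Num.truncn e^-1).
exists n.+1%:R^-1.
  rewrite invr_gt0 ltr0n /= invf_ple ?posrE ?ltr0n //.
  by rewrite ltW // (lt_le_trans (truncnS_gt _)) // ler_nat ltnS leq_maxr.
have := HN n (leq_maxl _ _) => /ltW.
have Bfin : fp_prob X (B n) \is a fin_num by exact: fin_num_measure.
by rewrite -lee_fin /= fineK.
Qed.

(** The delay moves a stopping time by less than delta. Outside an event of
    probability at most 2 e, the two paths are delta-close and X does not
    oscillate, so that the rewards differ by at most eta. *)
Lemma close_OS (X Y : filtered_process R) eta delta e : 0 < eta ->
  close d delta X Y -> delta <= e ->
  fine (fp_prob X (fp_proc X @^-1` oscillating eta delta)) <= e ->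
  (OS Y phi <= OS X phi + (eta + 4 * M * e)%:E /\
   OS X phi <= OS Y phi + (eta + 4 * M * e)%:E)%E.
Proof.
move=> eta0 [disp [T [pi [x [y [eps [[mx my pix piy] [sx sy] /andP[eps0 epsd] [cxy cyx] hd]]]]]]].
move=> de oe.
have M0 : 0 <= M by apply: le_trans (phiM (cadlag0 R) (t := 0) _); rewrite ?lexx ?ler01.
have mX : measurable_fun setT (fp_proc X) by exact: (measurable_fp_proc d_J1).
have mY : measurable_fun setT (fp_proc Y) by exact: (measurable_fp_proc d_J1).
set D := [set w | _] in hd.
pose O := fp_proc X @^-1` oscillating eta delta.
have mO : measurable O.
  rewrite -[X in measurable X]setTI; apply: mX => //.
  by apply: measurable_open; exact: open_oscillating.
have mD : measurable D.
  rewrite -[X in measurable X]setTI; apply: measurable_fun_ler => //.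
  exact: measurable_proc_dist.
have mxO : measurable (x @^-1` O) by rewrite -[X in measurable X]setTI; exact: mx.
(* The exceptional event: X oscillates, or the paths are far apart. *)
pose B := x @^-1` O `|` D.
have mB : measurable B by exact: measurableU.
have piB : 2 * M * fine (pi B) <= 4 * M * e.
  have piBe : fine (pi B) <= e + e.
    rewrite -lee_fin fineK; last exact: fin_num_measure.
    rewrite EFinD; apply: le_trans (measureU2 _ _ _) _ => //; apply: leeD.
      apply: (@le_trans _ _ (fp_prob X O)); first by rewrite -pix.
      have Ofin : fp_prob X O \is a fin_num by exact: fin_num_measure.
      by rewrite -(fineK Ofin) lee_fin.
    by apply: le_trans hd _; rewrite lee_fin.
  have : 2 * M * fine (pi B) <= 2 * M * (e + e) by rewrite ler_wpM2l // mulr_ge0.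
  by move/le_trans; apply; rewrite le_eqVlt; apply/orP; left; apply/eqP; ring.
have shift01 (u : R) : 0 <= u <= 1 -> `|clamp01 (u + eps) - u| < delta.
  move=> /andP[u0 u1]; rewrite /clamp01 max_r; last by rewrite le_min ler01 addr_ge0.
  have [h|h] := leP (u + eps) 1; first by rewrite addrAC subrr add0r ger0_norm.
  by rewrite ger0_norm ?subr_ge0 //; lra.
have near w s t : ~ B w -> 0 <= s <= 1 -> 0 <= t <= 1 -> `|s - t| < delta ->
    `|phi (fp_proc Y (y w), s) - phi (fp_proc X (x w), t)| <= eta.
  move=> nB s01 t01 st; rewrite leNgt; apply/negP => pe; apply: nB.
  have [Dw|nDw] := pselect (D w); first by right.
  left; exists (fp_proc Y (y w)), s, t; split => //.
  by rewrite ltNge; apply/negP.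
have mpair (Z : filtered_process R) (z : T -> fp_space Z) (h : T -> R) :
    measurable_fun setT z -> measurable_fun setT h ->
    measurable_fun setT (fun w => phi (fp_proc Z (z w), clamp01 (h w))).
  move=> mz mh.
  apply: (measurableT_comp mphi (g := fun w => (fp_proc Z (z w), h w))).
  apply: measurable_fun_pair => //; apply: measurableT_comp mz.
  exact: (measurable_fp_proc d_J1).
have reward_E (Z : filtered_process R) (z : T -> fp_space Z) tau :
    measurable_fun setT z -> stopping_time (X := Z) tau ->
    (forall A, measurable A -> pushforward pi z A = fp_prob Z A) ->
    (\int[pi]_w (phi (fp_proc Z (z w), tau (z w)))%:E =
     \int[fp_prob Z]_v (phi (fp_proc Z v, tau v))%:E)%E.
  move=> mz tauP piz; have mr := measurable_reward d_J1 mphi tauP.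
  rewrite -[RHS](@eq_measure_integral _ _ _ setT _ (pushforward pi z)); last first.
    by move=> A mA _; exact: piz.
  rewrite (integral_pushforward mz) //; first exact/measurable_EFinP.
  rewrite preimage_setT; apply: (bounded_integrable pi (measurableT_comp mr mz) (M := M)).
  by move=> w /=; apply: phiM; case: tauP.
split.
  rewrite -leeBlDr //; apply/ereal_infP => _ [tau tauP <-]; rewrite unlock leeBlDr //.
  have tau01 w : 0 <= tau w <= 1 by case: tauP.
  have mtau := measurable_stopping_time tauP.
  apply: le_trans (OS_le_causal d_J1 mphi phiM mx my sy piy eps0 cyx tauP) _.
  rewrite -(reward_E _ _ _ mx tauP pix).
  apply: (@le_trans _ _ (\int[pi]_w (phi (fp_proc X (x w), tau (x w)))%:E +
    (eta + 2 * M * fine (pi B))%:E)%E); last by rewrite leeD2l // lee_fin lerD2l.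
  apply: integral_le_up_to => //.
  - by apply: mpair => //; apply: measurable_funD => //; exact: measurableT_comp.
  - exact: (measurableT_comp (measurable_reward d_J1 mphi tauP) mx).
  - by move=> w; apply: phiM; exact: clamp01_itv.
  - by move=> w; exact: phiM.
  - exact: ltW.
  - move=> w nB; have := near w _ _ nB (clamp01_itv (tau (x w) + eps)) (tau01 (x w)) (shift01 _ (tau01 _)).
    by rewrite ler_norml => /andP[_]; rewrite lerBlDl.
rewrite -leeBlDr //; apply/ereal_infP => _ [tau tauP <-]; rewrite unlock leeBlDr //.
have tau01 w : 0 <= tau w <= 1 by case: tauP.
have mtau := measurable_stopping_time tauP.
apply: le_trans (OS_le_causal d_J1 mphi phiM my mx sx pix eps0 cxy tauP) _.
rewrite -(reward_E _ _ _ my tauP piy).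
apply: (@le_trans _ _ (\int[pi]_w (phi (fp_proc Y (y w), tau (y w)))%:E +
  (eta + 2 * M * fine (pi B))%:E)%E); last by rewrite leeD2l // lee_fin lerD2l.
apply: integral_le_up_to => //.
- by apply: mpair => //; apply: measurable_funD => //; exact: measurableT_comp.
- exact: (measurableT_comp (measurable_reward d_J1 mphi tauP) my).
- by move=> w; apply: phiM; exact: clamp01_itv.
- by move=> w; exact: phiM.
- exact: ltW.
- move=> w nB; have st := shift01 _ (tau01 (y w)); rewrite distrC in st.
  have := near w _ _ nB (tau01 (y w)) (clamp01_itv (tau (y w) + eps)) st.
  by rewrite distrC ler_norml => /andP[_]; rewrite lerBlDl.
Qed.

End continuous_reward.

(** * Stability of the value of optimal stopping *)

Lemma measurable_clamped_reward {R : realType} (phi : cadlag R * R -> R) :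
  measurable_fun (path_time R) phi ->
  measurable_fun setT (fun z : cadlag R * R => phi (z.1, clamp01 z.2)).
Proof.
move=> mphi.
have mp : measurable (path_time R) by apply: measurableX.
apply: (measurable_comp (g := fun z : cadlag R * R => (z.1, clamp01 z.2)) mp _ mphi).
- by move=> _ [z _ <-]; split=> //=; rewrite in_itv /=; exact: clamp01_itv.
- apply: measurable_fun_pair => //; apply: measurable_maxr => //.
  exact: measurable_minr.
Qed.

Unset Implicit Arguments.

Theorem theorem1p6 (R : realType) (d : cadlag R -> cadlag R -> R)
    (d_J1 : J1_metric d) (p : R) (p_ge1 : 1 <= p)
    (phi : cadlag R * R -> R)
    (phi_bounded : exists M : R, forall (f : cadlag R) (t : R),
       0 <= t <= 1 -> `|phi (f, t)| <= M)
    (phi_measurable : measurable_fun (path_time R) phi)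
    (phi_non_anticipative : non_anticipative phi) :
  (forall X Y : filtered_process R, FP d p X -> FP d p Y ->
     AW d p X Y = 0%E -> OS X phi = OS Y phi) /\
  (forall (X : filtered_process R) (Xn : nat -> filtered_process R),
     FP d p X -> (forall n, FP d p (Xn n)) ->
     AW d p (Xn n) X @[n --> \oo] --> 0%E ->
     {ae fp_prob X, forall w, {within `[0, 1], continuous (fp_proc X w)}} ->
     {within path_time R, continuous phi} ->
     OS (Xn n) phi @[n --> \oo] --> OS X phi).
Proof.
have [M phiM] := phi_bounded; have mphi := measurable_clamped_reward phi_measurable.
split=> [X Y _ _ AW0|X Xn _ _ AW0 _ phi_cont].
  have XY delta : 0 < delta <= 1 -> close d delta X Y.
    move=> delta01; apply: (AW_close d_J1 p_ge1 delta01).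
    by rewrite AW0 lte_fin exprn_gt0 //; case/andP: delta01.
  apply/le_anti; rewrite (OS_le_of_close d_J1 mphi phiM XY).
  rewrite (@OS_le_of_close _ d d_J1 Y X phi M mphi phiM) // => delta delta01.
  by apply: close_sym => //; exact: XY.
have M0 : 0 <= M by apply: le_trans (phiM (cadlag0 R) 0 _); rewrite ?lexx ?ler01.
have [r OSr _] := OS_fin d_J1 X mphi phiM.
have /choice[rn OSrn] n : exists rn, OS (Xn n) phi = rn%:E.
  by have [rn OSrn _] := OS_fin d_J1 (Xn n) mphi phiM; exists rn.
rewrite OSr (_ : (fun n => OS (Xn n) phi) = EFin \o rn); last exact/funext.
apply: cvg_EFin; first exact: nearW.
apply/cvgrPdist_le => e0 e0_gt0.
(* The error e0 / 2 + 4 M e of the comparison must not exceed e0. *)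
pose e := Num.min 1 (e0 / (2 * (4 * M + 1))).
have den0 : 0 < 2 * (4 * M + 1) by rewrite mulr_gt0 // ltr_wpDl // mulr_ge0.
have e_gt0 : 0 < e by rewrite lt_min ltr01 divr_gt0.
have e_le1 : e <= 1 by rewrite ge_min lexx.
have eta_gt0 : 0 < e0 / 2 by rewrite divr_gt0.
have e_small : e0 / 2 + 4 * M * e <= e0.
  have : e * (2 * (4 * M + 1)) <= e0 by rewrite -ler_pdivlMr // ge_min lexx orbT.
  lra.
have [delta /andP[delta0 delta_e] osc] := oscillating_small d_J1 phi_cont X eta_gt0 e_gt0.
have delta01 : 0 < delta <= 1 by rewrite delta0 (le_trans delta_e).
have AW_small : nbhs (0%E : \bar R) [set u | (u < (delta ^+ 2)%:E)%E].
  by apply: open_ereal_lt'; rewrite lte_fin exprn_gt0.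
have [N _ HN] := AW0 _ AW_small; exists N => // n /HN /= /(AW_close d_J1 p_ge1 delta01) XnX.
have := close_OS d_J1 mphi phiM phi_cont eta_gt0 (close_sym d_J1 XnX) delta_e osc.
rewrite OSr OSrn -!EFinD !lee_fin => -[h1 h2].
rewrite ler_norml; apply/andP; split; lra.
Qed.
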